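(* For any two distinct vertical planes $W_1,W_2\subset\mathbb{H}$ and any $\lambda\in(0,1)$: (i) there are entire $\lambda$-iLip graphs $\Gamma_1$ and $\Gamma_2$ over $W_1$ and $W_2$ respectively such that $\dim_H(\Gamma_1\cap\Gamma_2)<2$; and (ii) there are entire $\lambda$-iLip graphs $\Gamma_1$ and $\Gamma_2$ over $W_1$ and $W_2$ respectively such that $\dim_H(\Gamma_1\cap\Gamma_2)>2$.
   Context: $\mathbb{H}$ is the first Heisenberg group, identified with $\mathbb{R}^3$ with the group law $(x,y,z)(x',y',z')=\left(x+x',y+y',z+z'+\tfrac12(xy'-x'y)\right)$ and identity $\mathbf{0}$. The Kor\'anyi norm is $|(x,y,z)|_{\mathrm{Kor}}=\sqrt[4]{(x^2+y^2)^2+16z^2}$ and the distance is $d(a,b)=|b^{-1}a|_{\mathrm{Kor}}$; $d(p,W)=\inf_{w\in W}d(p,w)$. $\dim_H$ denotes Hausdorff dimension with respect to $d$. A vertical plane is a set $W=\{(x,y,z): ax+by=0\}$ with $(a,b)\neq(0,0)$. For $\lambda\in(0,1)$, $\mathrm{Cone}_{W,\lambda}=\{p\in\mathbb{H}: d(p,W)\le \lambda\,d(\mathbf{0},p)\}$. A set $E\subset\mathbb{H}$ is a $\lambda$-iLip (intrinsic $\lambda$-Lipschitz) graph over $W$ if $E\subset p\,\mathrm{Cone}_{W,\lambda}$ for all $p\in E$. Let $W^\perp\subset\{z=0\}$ be the one-parameter horizontal subgroup orthogonal to $W$; then $\mathbb{H}=W\cdot W^\perp$, and $\Pi_W\colon\mathbb{H}\to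 W$ denotes the projection $\Pi_W(wv)=w$ for $w\in W$, $v\in W^\perp$. A $\lambda$-iLip graph $E$ over $W$ is entire if $\Pi_W(E)=W$. *)

(* Defs.v *)
From mathcomp Require Import all_boot all_order all_algebra.
From mathcomp Require Import all_classical all_reals all_analysis.
From mathcomp Require Import ring lra.

Set Implicit Arguments.
Unset Strict Implicit.
Unset Printing Implicit Defensive.

Import Order.TTheory GRing.Theory Num.Theory.

Local Open Scope classical_set_scope.
Local Open Scope ring_scope.

Section HausdorffDimension.
Context {R : realType} {T : Type}.
Variable d : T -> T -> R.
Implicit Types (A E : set T) (U : (set T)^nat).

(* In \bar R, with diam set0 = -oo. *)
Definition diam A : \bar R := ereal_sup [set (d p.1 p.2)%:E | p in A `*` A].

(* The empty set weighs 0 for every s, and a point weighs 0 `^ 0 = 1 for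
   s = 0, so that the 0-dimensional measure is the counting measure. *)
Definition hausdorff_weight (s : R) A : \bar R :=
  if A == set0 then 0%E else (diam A `^ s)%E.

Definition hausdorff_content (s delta : R) E : \bar R :=
  ereal_inf [set (\sum_(0 <= i <oo) hausdorff_weight s (U i))%E |
    U in [set U | E `<=` \bigcup_i U i /\
                  forall i, (diam (U i) <= delta%:E)%E]].

Definition hausdorff_measure (s : R) E : \bar R :=
  ereal_sup [set hausdorff_content s delta E |
    delta in [set delta : R | 0 < delta]].

Definition hausdorff_dim E : \bar R :=
  ereal_inf [set s%:E | s in [set s : R | 0 <= s /\
                                          hausdorff_measure s E = 0%E]].

End HausdorffDimension.

(* A plain triple: the componentwise group structure and the sup norm that the
   library puts on R * R * R are not used. *)
Notation heis R := (R * R * R)%type.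

Section Heisenberg.
Context {R : realType}.
Implicit Types (p q v w : heis R) (W E : set (heis R)) (lam : R).

Definition heis0 : heis R := (0, 0, 0).

Definition hmul p q : heis R :=
  let: (x, y, z) := p in let: (x', y', z') := q in
  (x + x', y + y', z + z' + 2^-1 * (x * y' - x' * y)).

Definition hinv p : heis R := let: (x, y, z) := p in (- x, - y, - z).

Definition koranyi p : R :=
  let: (x, y, z) := p in
  Num.sqrt (Num.sqrt ((x ^+ 2 + y ^+ 2) ^+ 2 + 16 * z ^+ 2)).

Definition hdist p q : R := koranyi (hmul (hinv q) p).

Definition hdist_set p W : R := inf [set hdist p w | w in W].

Definition vertical_plane W : Prop :=
  exists a b : R, (a, b) <> (0, 0) /\
    W = [set p | a * p.1.1 + b * p.1.2 = 0].

Definition cone W lam : set (heis R) :=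
  [set p | hdist_set p W <= lam * hdist heis0 p].

Definition ilip_graph W lam E : Prop :=
  forall p, E p -> E `<=` hmul p @` cone W lam.

Definition hperp W : set (heis R) :=
  [set v | v.2 = 0 /\
     forall w, W w -> v.1.1 * w.1.1 + v.1.2 * w.1.2 + v.2 * w.2 = 0].

(* When W is a vertical plane the w below exists and is unique, see
   [hdecomp] and [hproj_hmul]. *)
Definition hproj W p : heis R :=
  xget heis0 [set w | W w /\ exists2 v, hperp W v & p = hmul w v].

Definition entire_ilip_graph W lam E : Prop :=
  ilip_graph W lam E /\ hproj W @` E = W.

Lemma hmulA p q v : hmul p (hmul q v) = hmul (hmul p q) v.
Proof.
by case: p => [[? ?] ?]; case: q => [[? ?] ?]; case: v => [[? ?] ?];
  congr (_, _, _); field.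
Qed.

Lemma hmul0 p : hmul p heis0 = p.
Proof. by case: p => [[? ?] ?]; congr (_, _, _); field. Qed.

Lemma hmulV p : hmul p (hinv p) = heis0.
Proof. by case: p => [[? ?] ?]; congr (_, _, _); field. Qed.

Let sqr_ab_neq0 (a b : R) : (a, b) <> (0, 0) -> a ^+ 2 + b ^+ 2 != 0.
Proof.
move=> ab0; apply/negP; rewrite paddr_eq0 ?sqr_ge0// !sqrf_eq0.
by move=> /andP[/eqP a0 /eqP b0]; apply: ab0; rewrite a0 b0.
Qed.

Lemma hdecomp W p : vertical_plane W ->
  exists w v, [/\ W w, hperp W v & p = hmul w v].
Proof.
move=> [a [b [/sqr_ab_neq0 ab0 ->]]]; case: p => [[x y] z].
pose t := (a * x + b * y) / (a ^+ 2 + b ^+ 2).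
exists (x - t * a, y - t * b, z - 2^-1 * (x * (t * b) - t * a * y)).
exists (t * a, t * b, 0); split => /=.
- by rewrite /t; field.
- split=> // w /= w0; transitivity (t * (a * w.1.1 + b * w.1.2)); first by ring.
  by rewrite w0 mulr0.
- by congr (_, _, _); field.
Qed.

Lemma hproj_hmul W w v : vertical_plane W -> W w -> hperp W v ->
  hproj W (hmul w v) = w.
Proof.
move=> vW Ww Wv; apply: xget_unique; first by split=> //; exists v.
move=> w' [Ww' [v' Wv' e]].
move: vW => [a [b [/sqr_ab_neq0 ab0 WE]]].
have Wba : W (- b, a, 0) by rewrite WE /=; ring.
move: Wv Wv' => [v0 /(_ _ Wba) /= vE] [v0' /(_ _ Wba) /= vE'].
move: Ww Ww'; rewrite {}WE {Wba}.
case: w v w' v' v0 v0' vE vE' e => [[x y] z] [[p q] r] [[x' y'] z'] [[p' q'] r'].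
move=> /= -> -> vE vE' [ex ey ez] wE wE'.
have px : p = x' + p' - x by rewrite -ex; ring.
have qy : q = y' + q' - y by rewrite -ey; ring.
have xx : x' = x.
  apply: (mulfI ab0); apply/eqP; rewrite -subr_eq0; apply/eqP.
  rewrite px qy in vE.
  have -> : (a ^+ 2 + b ^+ 2) * x' - (a ^+ 2 + b ^+ 2) * x =
    a * (a * x' + b * y') - a * (a * x + b * y)
    - b * ((x' + p' - x) * - b + (y' + q' - y) * a + 0 * 0)
    + b * (p' * - b + q' * a + 0 * 0) by ring.
  by rewrite wE wE' vE vE'; ring.
have yy : y' = y.
  apply: (mulfI ab0); apply/eqP; rewrite -subr_eq0; apply/eqP.
  rewrite px qy in vE.
  have -> : (a ^+ 2 + b ^+ 2) * y' - (a ^+ 2 + b ^+ 2) * y =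
    b * (a * x' + b * y') - b * (a * x + b * y)
    + a * ((x' + p' - x) * - b + (y' + q' - y) * a + 0 * 0)
    - a * (p' * - b + q' * a + 0 * 0) by ring.
  by rewrite wE wE' vE vE'; ring.
subst x' y'; congr (_, _, _).
have pp : p = p' by rewrite px; ring.
have qq : q = q' by rewrite qy; ring.
by move: ez; rewrite pp qq; lra.
Qed.

End Heisenberg.

(* Main.v *)
Require Import Defs.
From mathcomp Require Import all_boot all_order all_algebra.
From mathcomp Require Import all_classical all_reals all_analysis.
From mathcomp Require Import ring lra.

Set Implicit Arguments.
Unset Strict Implicit.
Unset Printing Implicit Defensive.

Import Order.TTheory GRing.Theory Num.Theory.
Import numFieldNormedType.Exports.

Local Open Scope classical_set_scope.
Local Open Scope ring_scope.

(** After normalizing the equation of a vertical plane, [W] is the kernel of a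
    homomorphism [hfun] from the group to the line, whose absolute value is the
    distance to [W].  Hence a set is an intrinsic [lam]-Lipschitz graph over [W]
    as soon as [hfun] is [lam]-Lipschitz on it for the Koranyi distance
    ([ilip_hfun]).  Since the distance satisfies the triangle inequality
    ([koranyi_mul]), McShane's formula extends [hfun] from any such set to a
    Lipschitz function [F] on the group, and the set of solutions of [hfun = F]
    is an entire graph with the same constant ([entire_extension]).

    Both parts therefore reduce to finding a set [E] on which the projection to
    the horizontal plane is Lipschitz with a tiny constant: it is contained in two
    entire graphs, one over each plane.  For the first part, [E] must moreover be
    all of their intersection.  Two points of the intersection cannot differ by a
    horizontal element, because both graphs are nearly flat in transverse
    directions; so it suffices that every point of the group is horizontally
    aligned with a point of [E].  When [E] is a curve going from bottom to top
    this is the intermediate value theorem ([curve_maximal]).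

    The curve is self-similar.  Its horizontal part is the lacunary series
    [gamma(t) = sum_k 4^-k e^(i b^k t)] with [b = 16 q] and [q] close to [1], and
    its height is the signed area swept by [gamma].  Each circle of the series
    sweeps an area proportional to time, and the area swept by the circle of
    index [k] per unit time is [q^k / 2].  When [q < 1] the total is
    [kappa = 1 / (2 (1 - q))]; when [q > 1] the series diverges, but the same value
    of [kappa] still gives a curve with the same self-similarity.  The increment
    [area s t] of the height, corrected by the group law, is then
    [16^-n kappa b^n (t - s)] up to [16 * 16^-n] when [|t - s|] is about [b^-n]
    ([area_main]), while the increment of [gamma] is at most [4 * 4^-n].  As
    [|kappa|] tends to infinity when [q] tends to [1], the curve is as vertical as
    desired ([curve_vertical]).

    The distance between [curve s] and [curve t] is thus comparable with [4^-n]
    when [|t - s|] is comparable with [(16 q)^-n], so the curve has dimension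
    [ln (16 q) / ln 4 = 2 + ln q / ln 4], which lies on either side of [2] according
    to the sign of [q - 1].  The upper bound comes from covering the curve by arcs
    ([snowflake_negligible]), the lower bound from the mass distribution principle
    ([hausdorff_dim_ge]). *)

(** * The Koranyi distance and entire graphs *)

Section KoranyiNorm.
Context {R : realType}.
Implicit Types (p q : heis R).

Lemma koranyi_ge0 p : 0 <= koranyi p.
Proof. by case: p => [[x y] z]; exact: sqrtr_ge0. Qed.

Lemma koranyi4 x y z :
  koranyi (x, y, z) ^+ 4 = (x ^+ 2 + y ^+ 2) ^+ 2 + 16 * z ^+ 2 :> R.
Proof.
rewrite /koranyi -[4%N]/(2 * 2)%N exprM sqr_sqrtr ?sqrtr_ge0// sqr_sqrtr//.
by rewrite addr_ge0 ?sqr_ge0// mulr_ge0 ?sqr_ge0.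
Qed.

Lemma koranyi_le x y z (m : R) : 0 <= m ->
  (koranyi (x, y, z) <= m) = ((x ^+ 2 + y ^+ 2) ^+ 2 + 16 * z ^+ 2 <= m ^+ 4).
Proof. by move=> m0; rewrite -koranyi4 ler_pXn2r// nnegrE koranyi_ge0. Qed.

Lemma koranyi_horizontal x y z :
  x ^+ 2 + y ^+ 2 <= koranyi (x, y, z) ^+ 2 :> R.
Proof.
rewrite -(@ler_pXn2r _ 2)// ?nnegrE ?addr_ge0 ?sqr_ge0//.
by rewrite -exprM koranyi4 lerDl mulr_ge0 ?sqr_ge0.
Qed.

Lemma koranyi_vertical x y z : 4 * `|z| <= koranyi (x, y, z) ^+ 2 :> R.
Proof.
rewrite -(@ler_pXn2r _ 2)// ?nnegrE ?sqr_ge0 ?mulr_ge0//.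
rewrite -exprM koranyi4 exprMn -normrX ger0_norm ?sqr_ge0//.
have := sqr_ge0 (x ^+ 2 + y ^+ 2); lra.
Qed.

Lemma koranyi0 : koranyi heis0 = 0 :> R.
Proof. by rewrite /koranyi /= !(expr0n, mulr0, addr0, sqrtr0). Qed.

Lemma koranyi_inv p : koranyi (hinv p) = koranyi p.
Proof. by case: p => [[x y] z]; rewrite /koranyi /= !sqrrN. Qed.

Lemma minkowski2 (a c a' c' u v : R) : 0 <= u -> 0 <= v ->
  a ^+ 2 + c ^+ 2 <= u ^+ 2 -> a' ^+ 2 + c' ^+ 2 <= v ^+ 2 ->
  (a + a') ^+ 2 + (c + c') ^+ 2 <= (u + v) ^+ 2.
Proof.
move=> u0 v0 hu hv.
have dot : a * a' + c * c' <= u * v.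
  rewrite (le_trans (ler_norm _))// -(@ler_pXn2r _ 2)// ?nnegrE ?mulr_ge0//.
  rewrite -normrX ger0_norm ?sqr_ge0// exprMn.
  apply: (@le_trans _ _ ((a ^+ 2 + c ^+ 2) * (a' ^+ 2 + c' ^+ 2))).
    by have := sqr_ge0 (a * c' - c * a'); nra.
  by apply: ler_pM => //; rewrite addr_ge0 ?sqr_ge0.
nra.
Qed.

(** Cygan's inequality.  The fourth power of the norm of [(v, z)] is the squared
    modulus of the complex number [|v|^2 + 4 i z], and the product [(v, z)(v', z')]
    has for complex number the sum of those of its factors and of
    [2 (v . v' + i v /\ v')], whose modulus is [2 |v| |v'|]. *)
Lemma koranyi_mul p q : koranyi (hmul p q) <= koranyi p + koranyi q.
Proof.
case: p q => [[x y] z] [[x' y'] z'].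
have N0 := koranyi_ge0 (x, y, z); have N0' := koranyi_ge0 (x', y', z').
have := koranyi4 x y z; have := koranyi4 x' y' z'.
have := koranyi_horizontal x y z; have := koranyi_horizontal x' y' z'.
rewrite [X in X <= _]/= koranyi_le ?addr_ge0//.
move: (koranyi (x, y, z)) (koranyi (x', y', z')) N0 N0' => N N' N0 N0' h' h e' e.
have -> : ((x + x') ^+ 2 + (y + y') ^+ 2) ^+ 2 +
    16 * (z + z' + 2^-1 * (x * y' - x' * y)) ^+ 2 =
  (x ^+ 2 + y ^+ 2 + (x' ^+ 2 + y' ^+ 2) + 2 * (x * x' + y * y')) ^+ 2 +
  (4 * z + 4 * z' + 2 * (x * y' - x' * y)) ^+ 2 by field.
have -> : (N + N') ^+ 4 = (N ^+ 2 + N' ^+ 2 + 2 * (N * N')) ^+ 2 by ring.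
apply: minkowski2; rewrite ?mulr_ge0 ?addr_ge0 ?sqr_ge0//.
  apply: minkowski2; rewrite ?sqr_ge0// -exprM.
    by rewrite e; lra.
  by rewrite e'; lra.
have -> : (2 * (x * x' + y * y')) ^+ 2 + (2 * (x * y' - x' * y)) ^+ 2 =
  4 * ((x ^+ 2 + y ^+ 2) * (x' ^+ 2 + y' ^+ 2)) by ring.
have -> : (2 * (N * N')) ^+ 2 = 4 * (N ^+ 2 * N' ^+ 2) by ring.
by rewrite ler_pM2l// ler_pM// addr_ge0 ?sqr_ge0.
Qed.

Lemma hdistE x y z x' y' z' : hdist (x, y, z) (x', y', z') =
  koranyi (x - x', y - y', z - z' - 2^-1 * (x' * y - y' * x)) :> R.
Proof. by rewrite /hdist; congr koranyi; rewrite /=; congr (_, _, _); ring. Qed.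

Lemma hdist_ge0 p q : 0 <= hdist p q.
Proof. exact: koranyi_ge0. Qed.

Lemma hinvM p q : hinv (hmul p q) = hmul (hinv q) (hinv p).
Proof.
by case: p q => [[x y] z] [[x' y'] z']; rewrite /=; congr (_, _, _); ring.
Qed.

Lemma hinvK p : hinv (hinv p) = p.
Proof. by case: p => [[x y] z]; rewrite /= !opprK. Qed.

Lemma hmulVK p q : hmul p (hmul (hinv p) q) = q.
Proof.
rewrite hmulA hmulV; case: q => [[x y] z].
by rewrite /heis0 /=; congr (_, _, _); ring.
Qed.

Lemma hdistC p q : hdist p q = hdist q p.
Proof. by rewrite /hdist -koranyi_inv hinvM hinvK. Qed.

Lemma hdistxx p : hdist p p = 0.
Proof. by rewrite /hdist -[X in hmul _ X]hinvK hmulV koranyi0. Qed.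

Lemma hdist_triangle q p p' : hdist p p' <= hdist p q + hdist q p'.
Proof.
rewrite addrC /hdist; apply: le_trans (koranyi_mul _ _).
by rewrite -hmulA hmulVK.
Qed.

End KoranyiNorm.

Section PlaneFunctional.
Context {R : realType}.
Variables (a b : R) (ab1 : a ^+ 2 + b ^+ 2 = 1).
Implicit Types (p q : heis R) (E : set (heis R)) (lam : R).

Definition hfun p := a * p.1.1 + b * p.1.2.
Definition hplane : set (heis R) := [set p | hfun p = 0].
Definition hnormal (s : R) : heis R := (s * a, s * b, 0).

Lemma vertical_hplane : vertical_plane hplane.
Proof.
exists a, b; split=> // -[a0 b0]; move: ab1; rewrite a0 b0 !expr0n addr0 => /esym.
by move/eqP; rewrite oner_eq0.
Qed.

Lemma hfunM p q : hfun (hmul p q) = hfun p + hfun q.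
Proof. by case: p q => [[x y] z] [[x' y'] z']; rewrite /hfun /=; ring. Qed.

Lemma hfunV p : hfun (hinv p) = - hfun p.
Proof. by case: p => [[x y] z]; rewrite /hfun /=; ring. Qed.

Lemma hfun_normal s : hfun (hnormal s) = s.
Proof.
by rewrite /hfun /= -[RHS]mulr1 -ab1; ring.
Qed.

Lemma hperp_normal s : hperp hplane (hnormal s).
Proof.
split=> // w w0; rewrite /= mul0r addr0.
by rewrite -!mulrA -mulrDr (_ : _ + _ = 0) ?mulr0.
Qed.

Lemma hplane_decomp p : exists2 w, hplane w & p = hmul w (hnormal (hfun p)).
Proof.
exists (hmul p (hinv (hnormal (hfun p)))).
  by rewrite /hplane /mkset hfunM hfunV hfun_normal subrr.
by rewrite -hmulA -[X in hmul (hinv _) X]hinvK hmulV hmul0.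
Qed.

Lemma koranyi_normal s : koranyi (hnormal s) = `|s|.
Proof.
rewrite /koranyi /= expr0n mulr0 addr0.
have -> : (s * a) ^+ 2 + (s * b) ^+ 2 = s ^+ 2 by rewrite -[RHS]mulr1 -ab1; ring.
by rewrite sqrtr_sqr ger0_norm ?sqr_ge0// sqrtr_sqr.
Qed.

(** The nearest point is reached along the horizontal line orthogonal to the
    plane. *)
Lemma hdist_set_hplane p : hdist_set p hplane <= `|hfun p|.
Proof.
have [w w0 pE] := hplane_decomp p.
rewrite /hdist_set; apply: ge_inf; first by exists 0 => _ [v _ <-]; exact: hdist_ge0.
exists w => //; rewrite /hdist [in LHS]pE hmulA.
rewrite -[X in hmul (hmul _ X) _]hinvK hmulV.
rewrite (_ : hmul heis0 _ = hnormal (hfun p)) ?koranyi_normal//.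
by rewrite /heis0 /hnormal /=; congr (_, _, _); ring.
Qed.

(** The coset of a point modulo the normal subgroup [hplane] is determined by
    [hfun], so the cone condition only involves [hfun] and the distance. *)
Lemma ilip_hfun lam E :
  (forall p q, E p -> E q -> `|hfun p - hfun q| <= lam * hdist p q) ->
  ilip_graph hplane lam E.
Proof.
move=> El p Ep q Eq; exists (hmul (hinv p) q); last exact: hmulVK.
rewrite /cone /=; apply: le_trans (hdist_set_hplane _) _.
rewrite hfunM hfunV addrC (le_trans (El _ _ Eq Ep))//.
rewrite /hdist (_ : hmul _ heis0 = hinv (hmul (hinv p) q)) ?koranyi_inv//.
by rewrite hmul0.
Qed.

Lemma contraction_fixpoint (f : R -> R) lam : lam < 1 ->
  (forall s t, `|f s - f t| <= lam * `|s - t|) -> exists s, f s = s.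
Proof.
move=> lam1 fl.
have lam0 : 0 <= lam by have := fl 1 0; rewrite subr0 normr1 mulr1; exact: le_trans.
pose m := `|f 0| / (1 - lam).
have m0 : 0 <= m by rewrite divr_ge0// subr_ge0 ltW.
have mE : m = lam * m + `|f 0| by rewrite /m; field; lra.
have cf : continuous (fun s => s - f s).
  move=> s; apply/(@cvgrPdist_lt _ R) => e e0; near=> t.
  rewrite (_ : _ - _ = (s - t) - (f s - f t)); last by ring.
  apply: le_lt_trans (ler_normB _ _) _.
  apply: (@le_lt_trans _ _ (2 * `|s - t|)).
    have := fl s t; have := normr_ge0 (s - t); nra.
  suff : `|s - t| < e / 2 by lra.
  by near: t; apply: cvgr_dist_lt; [exact: cvg_id|rewrite divr_gt0].
have f1 := fl m 0; have f2 := fl (- m) 0.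
rewrite !subr0 ?normrN (ger0_norm m0) in f1 f2.
have [] := @IVT _ (fun s => s - f s) (- m) m 0.
- lra.
- by move=> x; apply: continuous_subspaceT.
- move: f1 f2; rewrite !ler_norml => /andP[f1 f1'] /andP[f2 f2'].
  have [n1 n2] : - f 0 <= `|f 0| /\ f 0 <= `|f 0|.
    by split; rewrite ?ler_norm// -normrN ler_norm.
  by rewrite ge_min le_max; apply/andP; split; apply/orP; [left|right]; lra.
by move=> c _ /eqP; rewrite subr_eq0 => /eqP; exists c.
Unshelve. all: by end_near. Qed.

(** An intrinsic graph extends to an entire one with the same constant.  McShane's
    formula extends [hfun] from [E] to a [lam]-Lipschitz function [F] on the whole
    group; on every horizontal line orthogonal to the plane [hfun] is an arc length
    parameter and [F] is a contraction of it, so [hfun = F] has one solution there. *)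
Lemma entire_extension lam E : 0 <= lam -> lam < 1 -> E !=set0 ->
  (forall p q, E p -> E q -> `|hfun p - hfun q| <= lam * hdist p q) ->
  exists G, [/\ E `<=` G, hproj hplane @` G = hplane &
    forall p q, G p -> G q -> `|hfun p - hfun q| <= lam * hdist p q].
Proof.
move=> lam0 lam1 [e0 Ee0] El.
pose S q := [set hfun e + lam * hdist e q | e in E].
pose F q := inf (S q).
have lbS q : has_lbound (S q).
  exists (hfun e0 - lam * hdist e0 q) => _ [e Ee <-].
  have := El _ _ Ee0 Ee; rewrite ler_norml => /andP[_ e0e].
  have := ler_wpM2l lam0 (hdist_triangle q e0 e); rewrite (hdistC q e); lra.
have S0 q : S q !=set0 by exists (hfun e0 + lam * hdist e0 q), e0.
have FD p q : F p <= F q + lam * hdist p q.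
  rewrite -lerBlDr; apply: lb_le_inf => // _ [e Ee <-].
  rewrite lerBlDr; apply: le_trans (_ : hfun e + lam * hdist e p <= _).
    by apply: ge_inf => //; exists e.
  have := ler_wpM2l lam0 (hdist_triangle q e p); rewrite (hdistC q p); lra.
have Fl p q : `|F p - F q| <= lam * hdist p q.
  rewrite ler_norml lerBrDr addrC lerBlDl.
  by have := FD p q; have := FD q p; rewrite (hdistC q p); lra.
have FE e : E e -> F e = hfun e.
  move=> Ee; apply/eqP; rewrite eq_le; apply/andP; split.
    by apply: ge_inf => //; exists e => //; rewrite hdistxx mulr0 addr0.
  apply: lb_le_inf => // _ [e' Ee' <-].
  by have := El _ _ Ee Ee'; rewrite (hdistC e) ler_norml => /andP[_]; lra.
exists [set p | hfun p = F p]; split.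
- by move=> e Ee /=; rewrite FE.
- rewrite eqEsubset; split=> [_ [p _ <-]|w w0].
    have [w w0 ->] := hplane_decomp p.
    by rewrite (hproj_hmul vertical_hplane w0)//; exact: hperp_normal.
  have [|s sE] := @contraction_fixpoint (fun s => F (hmul w (hnormal s))) lam lam1.
    move=> s t; apply: le_trans (Fl _ _) _; rewrite ler_wpM2l//.
    rewrite (_ : hdist _ _ = koranyi (hnormal (s - t))) ?koranyi_normal//.
    rewrite /hdist hinvM -hmulA (hmulA (hinv w)) -[X in hmul (hmul _ X) _]hinvK hmulV.
    rewrite -koranyi_normal; congr koranyi; rewrite /heis0 /hnormal /=; congr (_, _, _); ring.
  exists (hmul w (hnormal s)).
    by rewrite /= hfunM hfun_normal w0 add0r.
  by rewrite (hproj_hmul vertical_hplane w0)//; exact: hperp_normal.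
- by move=> p q /= -> ->.
Qed.

End PlaneFunctional.

Lemma vertical_planeP {R : realType} (W : set (heis R)) : vertical_plane W ->
  exists a b : R, a ^+ 2 + b ^+ 2 = 1 /\ W = hplane a b.
Proof.
move=> [a [b [ab ->]]].
have n0 : 0 < Num.sqrt (a ^+ 2 + b ^+ 2).
  rewrite sqrtr_gt0 lt_neqAle addr_ge0 ?sqr_ge0// andbT eq_sym.
  rewrite paddr_eq0 ?sqr_ge0// !sqrf_eq0; apply/negP => /andP[/eqP a0 /eqP b0].
  by apply: ab; rewrite a0 b0.
have := sqr_sqrtr (addr_ge0 (sqr_ge0 a) (sqr_ge0 b)).
move: (Num.sqrt _) n0 => n n0 nE.
exists (a / n), (b / n); split.
  by rewrite !expr_div_n -mulrDl -nE divff// expf_neq0// gt_eqF.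
apply/seteqP; split => p /=; rewrite /hplane /hfun /= => pE.
  by rewrite mulrAC [X in _ + X]mulrAC -mulrDl pE mul0r.
have -> : a * p.1.1 + b * p.1.2 = n * (a / n * p.1.1 + b / n * p.1.2).
  by field; rewrite gt_eqF.
by rewrite pE mulr0.
Qed.

(** * Trigonometric estimates and geometric sums *)

Section Trigonometry.
Context {R : realType}.
Implicit Types (x y m : R).

Lemma derive_bounded_dist (f df : R -> R) m x y :
  (forall c : R, is_derive c (1 : R) f (df c)) ->
  (forall c, `|c - y| <= `|x - y| -> `|df c| <= m) ->
  `|f x - f y| <= m * `|x - y|.
Proof.
move=> fd fm.
have fc (a b : R) : {within `[a, b], continuous f}.
  apply: continuous_subspaceT => c.
  by apply/differentiable_continuous/derivable1_diffP; case: (fd c).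
have [xy|xy|->] := ltgtP x y; last by rewrite !subrr normr0 mulr0.
- have [c] := MVT xy (fun c _ => fd c) (fc _ _); rewrite in_itv /= => /andP[xc cy] e.
  rewrite distrC e normrM (distrC x) ler_wpM2r// fm//.
  by rewrite ltr0_norm ?ltr0_norm ?subr_lt0//; lra.
- have [c] := MVT xy (fun c _ => fd c) (fc _ _); rewrite in_itv /= => /andP[xc cy] e.
  rewrite e normrM ler_wpM2r// fm//.
  by rewrite gtr0_norm ?gtr0_norm ?subr_gt0//; lra.
Qed.

Lemma sin_dist x y : `|sin x - sin y| <= `|x - y|.
Proof.
rewrite -[leRHS]mul1r; apply: (derive_bounded_dist (df := cos)) => // c _.
exact: cos_max.
Qed.

Lemma cos_dist x y : `|cos x - cos y| <= `|x - y|.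
Proof.
rewrite -[leRHS]mul1r; apply: (derive_bounded_dist (df := fun x => - sin x)) => // c _.
by rewrite normrN sin_max.
Qed.

Lemma sin_taylor1 x y : `|sin (x + y) - sin x - y * cos x| <= y ^+ 2.
Proof.
have /(_ (x + y) x) := @derive_bounded_dist (fun u => sin u - cos x * u)
  (fun u => cos u - cos x *: 1) `|y|.
rewrite [x + y - x]addrAC subrr add0r -normrM -expr2 ger0_norm ?sqr_ge0//.
rewrite (_ : _ - _ - (_ - _) = sin (x + y) - sin x - y * cos x); last by ring.
apply=> c cy; rewrite /GRing.scale /= mulr1.
exact: le_trans (cos_dist _ _) cy.
Qed.

End Trigonometry.

Section GeometricSums.
Context {R : realType}.
Implicit Types (u : R^nat) (a b c m t : R) (f : R -> R).

Lemma cvg_norm_le (u : nat -> R) (l m : R) :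
  u n @[n --> \oo] --> l -> (forall n, `|u n| <= m) -> `|l| <= m.
Proof.
move=> ul um; apply: (ler_cvg_to (cvg_norm ul) (cvg_cst m)).
exact: nearW.
Qed.

Lemma geometric_sum_le a n : 0 <= a < 1 ->
  \sum_(0 <= k < n) a ^+ k <= (1 - a)^-1.
Proof.
move=> /andP[a0 a1].
have -> : \sum_(0 <= k < n) a ^+ k = (1 - a ^+ n) / (1 - a).
  elim: n => [|n IHn]; first by rewrite big_geq// expr0 subrr mul0r.
  by rewrite big_nat_recr//= IHn exprS; field; lra.
by rewrite ler_pdivrMr ?subr_gt0// mulVf ?gerBl ?exprn_ge0// gt_eqF// subr_gt0.
Qed.

Lemma geometric_dominated u a m : 0 <= a < 1 -> (forall k, `|u k| <= m * a ^+ k) ->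
  series u n @[n --> \oo] --> limn (series u) /\ `|limn (series u)| <= m / (1 - a).
Proof.
move=> a01 um; have cu : cvgn (series u).
  apply: normed_cvg; apply: (@series_le_cvg _ _ (geometric m a)) => //.
  - by move=> n /=.
  - by move=> n; exact: le_trans (normr_ge0 _) (um n).
  - by apply: is_cvg_geometric_series; rewrite ger0_norm; case/andP: a01.
split=> //; apply: (cvg_norm_le cu) => n.
rewrite /series/=; apply: le_trans (ler_norm_sum _ _ _) _.
apply: (@le_trans _ _ (\sum_(0 <= k < n) m * a ^+ k)); first exact: ler_sum.
have m0 : 0 <= m by have := le_trans (normr_ge0 _) (um 0%N); rewrite expr0 mulr1.
by rewrite -mulr_sumr ler_wpM2l// geometric_sum_le.
Qed.

(** The bounded solution of [F t = f t + a * F (b * t)], see [gsumE]. *)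
Definition gsum a b f t := limn (series (fun k => a ^+ k * f (b ^+ k * t))).

Lemma gsum_cvg a b f m t : 0 <= a < 1 -> (forall t, `|f t| <= m) ->
  series (fun k => a ^+ k * f (b ^+ k * t)) n @[n --> \oo] --> gsum a b f t /\
  `|gsum a b f t| <= m / (1 - a).
Proof.
move=> a01 fm; apply: geometric_dominated => // k.
have ak : 0 <= a ^+ k by rewrite exprn_ge0; case/andP: a01.
by rewrite normrM (ger0_norm ak) mulrC ler_wpM2r.
Qed.

Lemma gsumE a b f m t : 0 <= a < 1 -> (forall t, `|f t| <= m) ->
  gsum a b f t = f t + a * gsum a b f (b * t).
Proof.
move=> a01 fm; have [c1 _] := gsum_cvg b t a01 fm.
have [c2 _] := gsum_cvg b (b * t) a01 fm.
have c3 : f t + a * series (fun k => a ^+ k * f (b ^+ k * (b * t))) n @[n --> \oo]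
    --> f t + a * gsum a b f (b * t).
  by apply: cvgD; [exact: cvg_cst|apply: cvgM => //; exact: cvg_cst].
have E : [sequence series (fun k => a ^+ k * f (b ^+ k * t)) n.+1]_n =
    (fun n => f t + a * series (fun k => a ^+ k * f (b ^+ k * (b * t))) n).
  apply/funext => n; rewrite /series /= big_nat_recl//= !expr0 !mul1r mulr_sumr.
  by congr (_ + _); apply: eq_bigr => k _; rewrite !exprS mulrA; congr (_ * f _); ring.
move: c1; rewrite -cvg_shiftS E => c1.
exact: cvg_unique c1 c3.
Qed.

(** Iterating the hypothesis [n] times produces [a ^+ n * m] and a geometric sum of
    ratio [a * b > 1], of which only the last term matters. *)
Lemma rescaling_decay (phi : R -> R -> R) a b c m s t n :
  0 < a -> 0 < b -> 3 <= a * b -> 0 <= c ->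
  (forall s t, phi s t <= m) ->
  (forall s t, phi s t <= c * `|t - s| + a * phi (b * s) (b * t)) ->
  b ^+ n * `|t - s| <= 1 -> phi s t <= (m + c) * a ^+ n.
Proof.
move=> a0 b0 ab c0 phim phiE h1.
(* The subtracted 1 is the slack that makes the bound inductive. *)
suff : phi s t <= m * a ^+ n + c * `|t - s| * ((a * b) ^+ n - 1).
  move=> /le_trans; apply; rewrite mulrDl lerD2l -mulrA ler_wpM2l//.
  apply: (@le_trans _ _ (`|t - s| * (a * b) ^+ n)).
    by rewrite ler_wpM2l// gerBl.
  rewrite exprMn mulrCA -[leRHS]mulr1 ler_wpM2l//; first by rewrite exprn_ge0// ltW.
  by rewrite mulrC.
elim: n s t {h1} => [|n IHn] s t; first by rewrite !expr0 subrr mulr0 addr0 mulr1.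
have := phiE s t; have := ler_wpM2l (ltW a0) (IHn (b * s) (b * t)).
rewrite -mulrBr normrM (gtr0_norm b0) !exprS.
set X := (a * b) ^+ n; set h := `|t - s|; set p := a ^+ n => h1 h2.
apply: le_trans h2 _.
have h0 : 0 <= c * h by rewrite mulr_ge0 ?normr_ge0.
have : c * h * 2 <= c * h * (a * b - 1) by rewrite ler_wpM2l//; lra.
nra.
Qed.

End GeometricSums.

(** * The self-similar curve *)

Section Curve.
Context {R : realType}.
Variable q : R.
Hypotheses (q_ge : 3 / 4 <= q) (q_le : q <= 5 / 4) (q_neq1 : q != 1).

Ltac qlra := have := q_ge; have := q_le; lra.

Local Notation r := (4^-1 : R).
Local Notation b := (16 * q).
Let w k := b ^+ k.+1 - 1.

(** The horizontal part of the curve is [gamma = (curvex, curvey)], with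
    [gamma t = e t + r * gamma (b * t)] for the unit circle [e = (cos, sin)]. *)
Definition curvex t := gsum r b cos t.
Definition curvey t := gsum r b sin t.
(** The termwise primitive of [2 * (cos t * curvex (b * t) + sin t * curvey (b * t))]. *)
Definition dot_primitive t := limn (series (fun k => r ^+ k * (2 / w k * sin (w k * t)))).
(** A primitive of the mixed term of the area form, [e /\ dg + g /\ de] with
    [g t = gamma (b * t)]: since [g /\ e' = g . e], integrating the first summand
    by parts leaves [e /\ g] plus twice the primitive of [e . g].  This expression
    makes sense even where [g] is not differentiable. *)
Definition cross_primitive t := cos t * curvey (b * t) - sin t * curvex (b * t) + dot_primitive t.
(** The sum of [q ^+ k / 2] over all [k], or its analytic continuation when
    [1 < q]. *)
Definition height_slope : R := (2 * (1 - q))^-1.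
Definition height_oscillation t := gsum 16^-1 b (fun u => 8^-1 * cross_primitive u) t.
(** The height satisfies the self-similarity [curvezE], where [t / 2] is the area
    swept by the unit circle and [cross_primitive] the interaction with the smaller
    circles. *)
Definition curvez t := height_slope * t + height_oscillation t.
(** The vertical component of [(curve s)^-1 (curve t)]. *)
Definition area s t :=
  curvez t - curvez s - 2^-1 * (curvex s * curvey t - curvey s * curvex t).

Let r01 : 0 <= r < 1. Proof. by apply/andP; split; lra. Qed.
Let b_gt0 : 0 < b. Proof. by qlra. Qed.

Let expb_ge0 k : 0 <= b ^+ k. Proof. by rewrite exprn_ge0// ltW. Qed.

Let expb_ge k : 12 <= b ^+ k.+1.
Proof.
elim: k => [|k IHk]; first by rewrite expr1; qlra.
rewrite exprS; apply: le_trans (_ : b * 12 <= _); first by qlra.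
by rewrite ler_wpM2l// ltW.
Qed.

Lemma curvex_cvg t :
  series (fun k => r ^+ k * cos (b ^+ k * t)) n @[n --> \oo] --> curvex t.
Proof. by have [] := gsum_cvg b t r01 (@cos_max R). Qed.

Lemma curvey_cvg t :
  series (fun k => r ^+ k * sin (b ^+ k * t)) n @[n --> \oo] --> curvey t.
Proof. by have [] := gsum_cvg b t r01 (@sin_max R). Qed.

Lemma curvex_le t : `|curvex t| <= 4 / 3.
Proof.
have [_ /le_trans] := gsum_cvg b t r01 (@cos_max R); apply.
by rewrite ler_pdivrMr; lra.
Qed.

Lemma curvey_le t : `|curvey t| <= 4 / 3.
Proof.
have [_ /le_trans] := gsum_cvg b t r01 (@sin_max R); apply.
by rewrite ler_pdivrMr; lra.
Qed.

Lemma curvexE t : curvex t = cos t + r * curvex (b * t).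
Proof. exact: (gsumE b t r01 (@cos_max R)). Qed.

Lemma curveyE t : curvey t = sin t + r * curvey (b * t).
Proof. exact: (gsumE b t r01 (@sin_max R)). Qed.

Lemma dot_primitive_cvg t :
  series (fun k => r ^+ k * (2 / w k * sin (w k * t))) n @[n --> \oo] --> dot_primitive t /\
  `|dot_primitive t| <= 1.
Proof.
have [|c v1] := @geometric_dominated _
  (fun k => r ^+ k * (2 / w k * sin (w k * t))) r (2 / 11) r01.
  move=> k; have rk : 0 <= r ^+ k by rewrite exprn_ge0.
  rewrite normrM (ger0_norm rk) mulrC ler_wpM2r//.
  have wk : 11 <= w k by have := expb_ge k; rewrite /w; lra.
  rewrite normrM ger0_norm ?divr_ge0//; last lra.
  rewrite -[leRHS]mulr1; apply: ler_pM => //; rewrite ?divr_ge0 ?sin_max//; first lra.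
  by rewrite ler_wpM2l// lef_pV2 ?posrE//; lra.
by split=> //; apply: le_trans v1 _; rewrite ler_pdivrMr; lra.
Qed.

Lemma cross_primitive_le t : `|cross_primitive t| <= 4.
Proof.
have h1 : `|cos t * curvey (b * t)| <= 1 * (4 / 3).
  by rewrite normrM ler_pM// ?cos_max ?curvey_le.
have h2 : `|sin t * curvex (b * t)| <= 1 * (4 / 3).
  by rewrite normrM ler_pM// ?sin_max ?curvex_le.
have [_ h3] := dot_primitive_cvg t.
move: h1 h2 h3; rewrite /cross_primitive !ler_norml => /andP[? ?] /andP[? ?] /andP[? ?].
by apply/andP; split; lra.
Qed.

Let w8_le t : `|8^-1 * cross_primitive t| <= 2^-1.
Proof. by rewrite normrM ger0_norm//; have := cross_primitive_le t; lra. Qed.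

Let r2_01 : 0 <= (16^-1 : R) < 1. Proof. by apply/andP; split; lra. Qed.

Lemma height_oscillation_le t : `|height_oscillation t| <= 1.
Proof.
have [_ /le_trans] := gsum_cvg b t r2_01 w8_le; apply.
by rewrite ler_pdivrMr; lra.
Qed.

Lemma curvezE t : curvez t = t / 2 + 16^-1 * curvez (b * t) + 8^-1 * cross_primitive t.
Proof.
rewrite /curvez {1}/height_oscillation (gsumE b t r2_01 w8_le) -/(height_oscillation (b * t)).
by rewrite /height_slope; field; rewrite subr_eq0 eq_sym.
Qed.

Lemma cross_termE (B s t : R) :
  (cos t - cos s) * sin (B * s) - (sin t - sin s) * cos (B * s) =
  sin (B * s - t) - sin (B * s - s).
Proof. by rewrite !sinB; ring. Qed.

(** Interaction of the unit circle with the circle of frequency [B].  The bound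
    [|t - s|] is the length of the arc run on the unit circle; it improves when the
    faster circle has not moved either, because the terms of first order in [t - s]
    cancel. *)
Lemma cross_term_le (B s t : R) : 12 <= B ->
  `|2 / (B - 1) * (sin ((B - 1) * t) - sin ((B - 1) * s)) +
    2 * (sin (B * s - t) - sin (B * s - s))|
  <= 4 * `|t - s| * Order.min 1 (B * `|t - s|).
Proof.
move=> B12; have B1 : 0 < B - 1 by lra.
have B0 : 0 <= 2 / (B - 1) by rewrite divr_ge0// ltW.
have h0 := normr_ge0 (t - s).
rewrite minr_pMr ?mulr_ge0// mulr1 le_min; apply/andP; split.
  have h1 := sin_dist ((B - 1) * t) ((B - 1) * s).
  have h2 := sin_dist (B * s - t) (B * s - s).
  rewrite -mulrBr normrM (gtr0_norm B1) in h1.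
  rewrite (_ : _ - (_ - _) = - (t - s)) ?normrN in h2; last by ring.
  have h3 : `|2 / (B - 1) * (sin ((B - 1) * t) - sin ((B - 1) * s))| <= 2 * `|t - s|.
    rewrite normrM (ger0_norm B0) -mulrA ler_wpM2l//.
    by rewrite ler_pdivrMl.
  apply: le_trans (ler_normD _ _) _; rewrite [X in _ + X <= _]normrM ger0_norm//.
  by rewrite addrC; lra.
have h1 := sin_taylor1 ((B - 1) * s) ((B - 1) * (t - s)).
have h2 := sin_taylor1 ((B - 1) * s) (- (t - s)).
rewrite -mulrDr subrKC in h1.
rewrite (_ : (B - 1) * s - (t - s) = B * s - t) in h2; last by ring.
rewrite (_ : B * s - s = (B - 1) * s); last by ring.
set X := sin _ - _ - _ in h1; set Y := sin _ - _ - _ in h2.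
rewrite (_ : _ + _ = 2 / (B - 1) * X + 2 * Y); last by rewrite /X /Y; field; lra.
have h3 : `|2 / (B - 1) * X| <= 2 * (B - 1) * `|t - s| ^+ 2.
  rewrite normrM (ger0_norm B0) -!mulrA ler_wpM2l// ler_pdivrMl//.
  by apply: le_trans h1 _; rewrite exprMn -normrX (ger0_norm (sqr_ge0 _)); lra.
rewrite sqrrN -[X in _ <= X](ger0_norm (sqr_ge0 _)) normrX in h2.
apply: le_trans (ler_normD _ _) _; rewrite [X in _ + X <= _]normrM ger0_norm//.
move: h0 h2 h3; set h := `|t - s|; set u := `|Y|; set v := `|_|.
have -> : 4 * h * (B * h) = 4 * B * h ^+ 2 by ring.
have := sqr_ge0 h; nra.
Qed.

Lemma curvex_dist s t n : b ^+ n * `|t - s| <= 1 -> `|curvex t - curvex s| <= 4 * r ^+ n.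
Proof.
move=> h1; have := @rescaling_decay _ (fun s t => `|curvex t - curvex s|) r b 1 (8 / 3)
  s t n _ b_gt0 _ _ _ _ h1.
move=> /(_ _ _ _ _ _)/le_trans; apply; try by qlra.
- move=> s' t'; apply: le_trans (ler_normB _ _) _.
  by have := curvex_le t'; have := curvex_le s'; lra.
- move=> s' t'; rewrite (curvexE t') (curvexE s') mul1r.
  rewrite opprD addrACA -mulrBr; apply: le_trans (ler_normD _ _) _.
  by rewrite lerD ?cos_dist// normrM ger0_norm.
- by rewrite ler_wpM2r ?exprn_ge0//; qlra.
Qed.

Lemma curvey_dist s t n : b ^+ n * `|t - s| <= 1 -> `|curvey t - curvey s| <= 4 * r ^+ n.
Proof.
move=> h1; have := @rescaling_decay _ (fun s t => `|curvey t - curvey s|) r b 1 (8 / 3)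
  s t n _ b_gt0 _ _ _ _ h1.
move=> /(_ _ _ _ _ _)/le_trans; apply; try by qlra.
- move=> s' t'; apply: le_trans (ler_normB _ _) _.
  by have := curvey_le t'; have := curvey_le s'; lra.
- move=> s' t'; rewrite (curveyE t') (curveyE s') mul1r.
  rewrite opprD addrACA -mulrBr; apply: le_trans (ler_normD _ _) _.
  by rewrite lerD ?sin_dist// normrM ger0_norm.
- by rewrite ler_wpM2r ?exprn_ge0//; qlra.
Qed.

Let m1 (u : R) : `|Order.min 1 (b * `|u|)| <= 1.
Proof. by rewrite ger0_norm ?ge_min ?lexx// le_min ler01 mulr_ge0// ltW. Qed.

Lemma min_sum_decay h n : b ^+ n * `|h| <= 1 ->
  gsum r b (fun u : R => Order.min 1 (b * `|u|)) h <= 24 * r ^+ n.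
Proof.
pose S h := gsum r b (fun u : R => Order.min 1 (b * `|u|)) h.
move=> h1; have := @rescaling_decay _ (fun s t => S (t - s)) r b b (4 / 3)
  0 h n _ b_gt0 _ (ltW b_gt0) _ _.
rewrite subr0 => /(_ _ _ _ _ h1)/le_trans; apply; try by qlra.
- move=> s t; have [_] := gsum_cvg b (t - s) r01 m1.
  rewrite -/(S _) ler_norml => /andP[_ /le_trans]; apply.
  by rewrite ler_pdivrMr; lra.
- move=> s t; rewrite {1}/S (gsumE b _ r01 m1) -/(S _) mulrBr lerD2r.
  by rewrite ge_min lexx orbT.
- by rewrite ler_wpM2r ?exprn_ge0//; qlra.
Qed.

(** Twice the integral from [s] to [t] of [(g u - g s) . e u], for [g] as in
    [cross_primitive]: the part of the mixed area that does not factor through the increments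
    of [e] and [g]. *)
Definition cross_defect s t := dot_primitive t - dot_primitive s +
  2 * ((cos t - cos s) * curvey (b * s) - (sin t - sin s) * curvex (b * s)).

(** The integrand in [cross_defect] is bounded by the oscillation of [g], which is of order
    [r ^+ n] at this scale. *)
Lemma cross_defect_le s t n : b ^+ n.+1 * `|t - s| <= 1 ->
  `|cross_defect s t| <= 24 * `|t - s| * r ^+ n.
Proof.
move=> h1; pose T k := 2 / w k * (sin (w k * t) - sin (w k * s)) +
  2 * (sin (b ^+ k.+1 * s - t) - sin (b ^+ k.+1 * s - s)).
have cT : series (fun k => r ^+ k * T k) n @[n --> \oo] --> cross_defect s t.
  rewrite (_ : series _ = fun n =>
    series (fun k => r ^+ k * (2 / w k * sin (w k * t))) n -
    series (fun k => r ^+ k * (2 / w k * sin (w k * s))) n +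
    2 * ((cos t - cos s) * series (fun k => r ^+ k * sin (b ^+ k * (b * s))) n -
    (sin t - sin s) * series (fun k => r ^+ k * cos (b ^+ k * (b * s))) n)).
    apply: cvgD.
      by apply: cvgB; [have [] := dot_primitive_cvg t|have [] := dot_primitive_cvg s].
    apply: cvgM; first exact: cvg_cst.
    apply: cvgB; (apply: cvgM; first exact: cvg_cst).
      exact: curvey_cvg.
    exact: curvex_cvg.
  apply/funext; elim=> [|m IHm]; rewrite /series /=.
    by rewrite !big_geq//; ring.
  rewrite !big_nat_recr//=; move: IHm; rewrite /series /= => ->.
  rewrite /T -cross_termE.
  rewrite (_ : b ^+ m * (b * s) = b ^+ m.+1 * s); last by rewrite exprS; ring.
  by ring.
have [cS _] := gsum_cvg b (t - s) r01 m1.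
have : `|cross_defect s t| <= 4 * `|t - s| * gsum r b (fun u : R => Order.min 1 (b * `|u|)) (t - s).
  apply: (ler_cvg_to (cvg_norm cT) (cvgM (cvg_cst (4 * `|t - s|)) cS)).
  apply: nearW => m; rewrite /series /= mulr_sumr.
  apply: le_trans (ler_norm_sum _ _ _) _; apply: ler_sum => k _.
  have rk : 0 <= r ^+ k by rewrite exprn_ge0.
  rewrite normrM (ger0_norm rk) mulrCA ler_wpM2l//.
  apply: le_trans (cross_term_le _ _ (expb_ge k)) _; rewrite ler_wpM2l ?mulr_ge0//.
  by rewrite normrM (ger0_norm (expb_ge0 k)) mulrA -exprS.
move=> /le_trans; apply.
have := ler_wpM2l (mulr_ge0 (ler0n _ 4) (normr_ge0 (t - s))) (min_sum_decay h1).
by rewrite exprS; lra.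
Qed.

(** One step of self-similarity: the unit circle is nearly straight at small scale,
    so it only contributes its length [|t - s|] times the size [r ^+ n] of what the
    other circles do in the meantime. *)
Lemma area_rescale1 s t n : b ^+ n.+1 * `|t - s| <= 1 ->
  `|area s t - 16^-1 * area (b * s) (b * t)| <= 6 * `|t - s| * r ^+ n.
Proof.
move=> h1.
have -> : area s t - 16^-1 * area (b * s) (b * t) =
  2^-1 * ((t - s) - sin (t - s)) + 8^-1 * (
    (cos t - cos s) * (curvey (b * t) - curvey (b * s)) -
    (sin t - sin s) * (curvex (b * t) - curvex (b * s)) + cross_defect s t).
  rewrite /area (curvezE t) (curvezE s) (curvexE t) (curvexE s) (curveyE t) (curveyE s).
  by rewrite /cross_primitive /cross_defect sinB; field.
have h2 : b ^+ n * `|b * t - b * s| <= 1.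
  by rewrite -mulrBr normrM gtr0_norm// mulrA -exprSr.
have h0 := normr_ge0 (t - s).
have hr : `|t - s| <= r ^+ n.
  have h3 : `|t - s| <= (b ^+ n.+1)^-1.
    by rewrite -[leRHS]mulr1 ler_pdivlMl// exprn_gt0.
  apply: le_trans h3 _; rewrite exprVn lef_pV2 ?posrE ?exprn_gt0//.
  apply: (@le_trans _ _ (b ^+ n)).
    by apply: lerXn2r; rewrite ?nnegrE; qlra.
  by rewrite exprS ler_peMl//; qlra.
have e1 : `|(t - s) - sin (t - s)| <= `|t - s| * r ^+ n.
  have := sin_taylor1 0 (t - s); rewrite add0r sin0 cos0 subr0 mulr1 distrC.
  move=> /le_trans; apply; rewrite -[leLHS](ger0_norm (sqr_ge0 _)) normrX expr2.
  exact: ler_wpM2l.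
have e2 : `|(cos t - cos s) * (curvey (b * t) - curvey (b * s))| <=
    `|t - s| * (4 * r ^+ n).
  by rewrite normrM ler_pM ?cos_dist ?curvey_dist.
have e3 : `|(sin t - sin s) * (curvex (b * t) - curvex (b * s))| <=
    `|t - s| * (4 * r ^+ n).
  by rewrite normrM ler_pM ?sin_dist ?curvex_dist.
have e4 := cross_defect_le h1.
move: e1 e2 e3 e4; set p := `|_| * r ^+ n.
rewrite (mulrCA _ 4) -(mulrA 24) -(mulrA 6) -/p.
rewrite !ler_norml => /andP[? ?] /andP[? ?] /andP[? ?] /andP[? ?].
by apply/andP; split; lra.
Qed.

(** The errors of the successive steps grow geometrically, with ratio [r * b > 1], so
    that the last one dominates. *)
Lemma area_rescale s t n : b ^+ n * `|t - s| <= 1 ->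
  `|area s t - 16^-1 ^+ n * area (b ^+ n * s) (b ^+ n * t)| <= 12 * 16^-1 ^+ n.
Proof.
move=> h1.
(* Subtracting [r ^+ n] makes the bound inductive, since [r * b >= 3]. *)
suff : `|area s t - 16^-1 ^+ n * area (b ^+ n * s) (b ^+ n * t)| <=
    12 * `|t - s| * (b ^+ n * 16^-1 ^+ n - r ^+ n).
  move=> /le_trans; apply; rewrite -mulrA ler_wpM2l//.
  apply: (@le_trans _ _ (`|t - s| * (b ^+ n * 16^-1 ^+ n))).
    by rewrite ler_wpM2l// gerBl exprn_ge0.
  by rewrite mulrA (mulrC `|_|) ler_piMl ?exprn_ge0.
elim: n s t h1 => [|n IHn] s t h1.
  by rewrite !expr0 !mul1r !subrr !mulr0 normr0.
have h2 : b ^+ n * `|b * t - b * s| <= 1.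
  by rewrite -mulrBr normrM gtr0_norm// mulrA -exprSr.
have := IHn _ _ h2; have := area_rescale1 h1.
have e u : b ^+ n * (b * u) = b ^+ n.+1 * u by rewrite exprSr mulrA.
rewrite !e -mulrBr normrM (gtr0_norm b_gt0).
set A1 := area s t; set A2 := area (b * s) (b * t); set A3 := area _ (b ^+ n.+1 * t).
rewrite (exprS b) !(exprS _ n).
set h := `|t - s|; set B := b ^+ n; set p := r ^+ n; set u := 16^-1 ^+ n.
have h0 : 0 <= h * p by rewrite mulr_ge0 ?exprn_ge0 ?normr_ge0.
have : 3 * (h * p) <= 4 * q * (h * p) by rewrite ler_wpM2r//; qlra.
rewrite !ler_norml => ? /andP[? ?] /andP[? ?].
by apply/andP; split; nra.
Qed.

Lemma area_coarse s t : `|area s t - height_slope * (t - s)| <= 4.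
Proof.
have h1 : `|curvex s * curvey t| <= 4 / 3 * (4 / 3).
  by rewrite normrM ler_pM// ?curvex_le ?curvey_le.
have h2 : `|curvey s * curvex t| <= 4 / 3 * (4 / 3).
  by rewrite normrM ler_pM// ?curvex_le ?curvey_le.
move: h1 h2 (height_oscillation_le s) (height_oscillation_le t); rewrite /area /curvez.
rewrite !ler_norml => /andP[? ?] /andP[? ?] /andP[? ?] /andP[? ?].
by apply/andP; split; nra.
Qed.

(** The error does not depend on [q], whereas [height_slope] blows up as [q] tends
    to [1]; this is what makes the curve vertical. *)
Lemma area_main s t n : b ^+ n * `|t - s| <= 1 ->
  `|area s t - 16^-1 ^+ n * (height_slope * (b ^+ n * (t - s)))| <= 16 * 16^-1 ^+ n.
Proof.
move=> h1; have := area_rescale h1.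
have := area_coarse (b ^+ n * s) (b ^+ n * t); rewrite -mulrBr.
set u := 16^-1 ^+ n; have u0 : 0 <= u by rewrite exprn_ge0.
move=> /(ler_wpM2l u0); rewrite -{1}(ger0_norm u0) -normrM.
rewrite !ler_norml => /andP[? ?] /andP[? ?].
by apply/andP; split; nra.
Qed.

End Curve.

(** * The curve in the Heisenberg group *)

Lemma unbounded_expr {R : realType} (b h : R) : 2 <= b -> 0 < h ->
  exists n, 1 < b ^+ n * h.
Proof.
move=> b2 h0; exists (Num.bound h^-1).
rewrite -ltr_pdivrMr// div1r; apply: lt_le_trans (archi_boundP _) _.
  by rewrite invr_ge0 ltW.
apply: (@le_trans _ _ (2 ^+ Num.bound h^-1)).
  by rewrite -natrX ler_nat ltnW// ltn_expl.
by apply: lerXn2r; rewrite ?nnegrE; lra.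
Qed.

Lemma scale_of {R : realType} (b h : R) : 2 <= b -> 0 < h ->
  exists n, 1 < b ^+ n.+1 * h /\ (n = 0%N \/ b ^+ n * h <= 1).
Proof.
move=> b2 h0; have b0 : 0 < b by lra.
have [m hm minm] := ex_minnP (unbounded_expr b2 h0).
case: m hm minm => [|n] hm minm.
  exists 0%N; split; last by left.
  by rewrite expr0 mul1r in hm; rewrite expr1; nra.
exists n; split=> //; right; rewrite leNgt; apply/negP => /minm.
by rewrite ltnn.
Qed.

Section CurveInHeisenberg.
Context {R : realType}.
Variable q : R.
Hypotheses (q_ge : 3 / 4 <= q) (q_le : q <= 5 / 4) (q_neq1 : q != 1).

Ltac qlra := have := q_ge; have := q_le; lra.

Local Notation r := (4^-1 : R).
Local Notation b := (16 * q).
Local Notation kappa := (height_slope q).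

Definition curve t : heis R := (curvex q t, curvey q t, curvez q t).

Lemma hdist_curve s t : hdist (curve t) (curve s) =
  koranyi (curvex q t - curvex q s, curvey q t - curvey q s, area q s t).
Proof. by rewrite /curve hdistE. Qed.

Let b_gt0 : 0 < b. Proof. by qlra. Qed.

Let r2E n : (r ^+ n) ^+ 2 = 16^-1 ^+ n.
Proof.
by rewrite exprAC; congr (_ ^+ n); rewrite exprVn -natrX.
Qed.

Lemma curvexy_dist2 s t n : n = 0%N \/ b ^+ n * `|t - s| <= 1 ->
  (curvex q t - curvex q s) ^+ 2 + (curvey q t - curvey q s) ^+ 2 <= 32 * 16^-1 ^+ n.
Proof.
move=> hn.
have [hx hy] : `|curvex q t - curvex q s| <= 4 * r ^+ n /\
    `|curvey q t - curvey q s| <= 4 * r ^+ n.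
  case: hn => [->|hn]; last by split; [apply: curvex_dist|apply: curvey_dist].
  rewrite expr0 mulr1; split; apply: le_trans (ler_normB _ _) _.
    by have := curvex_le q t; have := curvex_le q s; lra.
  by have := curvey_le q t; have := curvey_le q s; lra.
have sq u : `|u| <= 4 * r ^+ n -> u ^+ 2 <= 16 * 16^-1 ^+ n.
  move=> hu; rewrite -[leLHS]ger0_norm ?sqr_ge0// normrX.
  apply: le_trans (_ : (4 * r ^+ n) ^+ 2 <= _).
    by rewrite ler_pXn2r// nnegrE// mulr_ge0 ?exprn_ge0.
  by rewrite exprMn r2E; lra.
by have := sq _ hx; have := sq _ hy; lra.
Qed.

Lemma area_ge s t n : 1 < b ^+ n.+1 * `|t - s| ->
  n = 0%N \/ b ^+ n * `|t - s| <= 1 ->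
  (`|kappa| / 20 - 16) * 16^-1 ^+ n <= `|area q s t|.
Proof.
move=> hn1 hn.
have un : 0 <= 16^-1 ^+ n :> R by rewrite exprn_ge0.
have main : `|area q s t - 16^-1 ^+ n * (kappa * (b ^+ n * (t - s)))| <=
    16 * 16^-1 ^+ n.
  case: hn => [->|]; last exact: area_main.
  by rewrite expr0 !mul1r mulr1; apply: le_trans (area_coarse q_ge q_le s t) _; lra.
have lead : `|kappa| / 20 * 16^-1 ^+ n <=
    `|16^-1 ^+ n * (kappa * (b ^+ n * (t - s)))|.
  rewrite normrM (ger0_norm un) mulrC ler_wpM2l// normrM ler_wpM2l//.
  rewrite normrM ger0_norm ?exprn_ge0//; last exact: ltW.
  move: hn1; rewrite exprS -mulrA => hn1.
  have : 0 <= b ^+ n * `|t - s| by rewrite mulr_ge0// exprn_ge0// ltW.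
  by move: (_ ^+ n * _) hn1 => H hn1 H0; have := q_le; nra.
have := ler_distD (area q s t) (16^-1 ^+ n * (kappa * (b ^+ n * (t - s)))) 0.
rewrite !subr0 distrC; lra.
Qed.

Lemma area_le s t n : b ^+ n * `|t - s| <= 1 ->
  `|area q s t| <= (`|kappa| + 16) * 16^-1 ^+ n.
Proof.
move=> hn; have := area_main q_ge q_le q_neq1 hn.
have un : 0 <= 16^-1 ^+ n :> R by rewrite exprn_ge0.
have lead : `|16^-1 ^+ n * (kappa * (b ^+ n * (t - s)))| <= `|kappa| * 16^-1 ^+ n.
  rewrite normrM (ger0_norm un) mulrC ler_wpM2r// normrM ler_piMr//.
  by rewrite normrM ger0_norm ?exprn_ge0//; exact: ltW.
have := ler_distD (16^-1 ^+ n * (kappa * (b ^+ n * (t - s)))) (area q s t) 0.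
rewrite !subr0; lra.
Qed.

(** At the scale of [|t - s|] the squared horizontal increment is at most
    [32 * 16^-n] and the vertical one at least [(|kappa| / 20 - 16) * 16^-n]; the
    number [20] bounds [b], which is the ratio between two scales. *)
Lemma curve_vertical m s t : 0 <= m -> 8 <= m ^+ 2 * (`|kappa| / 20 - 16) ->
  (curvex q t - curvex q s) ^+ 2 + (curvey q t - curvey q s) ^+ 2 <=
  (m * hdist (curve t) (curve s)) ^+ 2.
Proof.
move=> m0 hm; have [->|ts] := eqVneq t s.
  by rewrite !subrr expr0n addr0 sqr_ge0.
have h0 : 0 < `|t - s| by rewrite normr_gt0 subr_eq0.
have [|n [hn1 hn]] := @scale_of _ b _ _ h0; first by qlra.
have h1 := curvexy_dist2 hn; have h2 := area_ge hn1 hn.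
have h3 := koranyi_vertical (curvex q t - curvex q s) (curvey q t - curvey q s) (area q s t).
rewrite -hdist_curve in h3.
have un : 0 <= 16^-1 ^+ n :> R by rewrite exprn_ge0.
rewrite exprMn; apply: le_trans h1 _.
apply: (@le_trans _ _ (m ^+ 2 * (4 * `|area q s t|))); last by rewrite ler_wpM2l ?sqr_ge0.
have := ler_wpM2l (sqr_ge0 m) h2; have := ler_wpM2r un hm.
lra.
Qed.

Lemma curve_dist_ge s t : 1 <= `|kappa| / 20 - 16 -> 0 < `|t - s| -> `|t - s| <= 1 ->
  exists n, b ^+ n * `|t - s| <= 1 /\ r ^+ n <= hdist (curve t) (curve s).
Proof.
move=> kap h0 h1; have [|n [hn1 hn]] := @scale_of _ b _ _ h0; first by qlra.
have hn' : b ^+ n * `|t - s| <= 1.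
  by case: hn => // ->; rewrite expr0 mul1r.
exists n; split=> //.
rewrite -(@ler_pXn2r _ 2)// ?nnegrE ?exprn_ge0 ?hdist_ge0//.
have := koranyi_vertical (curvex q t - curvex q s) (curvey q t - curvey q s) (area q s t).
rewrite -hdist_curve r2E; apply: le_trans.
have un : 0 <= 16^-1 ^+ n :> R by rewrite exprn_ge0.
by have := area_ge hn1 hn; nra.
Qed.

Lemma curve_dist_le s t n : b ^+ n * `|t - s| <= 1 ->
  hdist (curve t) (curve s) <= 4 * (`|kappa| + 16) * r ^+ n.
Proof.
move=> hn; rewrite hdist_curve.
have k0 := normr_ge0 kappa.
have r0 : 0 <= r ^+ n by rewrite exprn_ge0.
rewrite koranyi_le; last by rewrite mulr_ge0// mulr_ge0// addr_ge0.
have h1 := curvexy_dist2 (or_intror hn); have h2 := area_le hn.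
have -> : (4 * (`|kappa| + 16) * r ^+ n) ^+ 4 =
  ((4 * (`|kappa| + 16)) ^+ 2 * (r ^+ n) ^+ 2) ^+ 2 by ring.
rewrite r2E.
have un : 0 <= 16^-1 ^+ n :> R by rewrite exprn_ge0.
move: un h1 h2; set u := 16^-1 ^+ n; set X := _ + _; set K := `|kappa| + 16.
have K16 : 16 <= K by rewrite lerDr.
move=> un h1 h2.
have X0 : 0 <= X by rewrite addr_ge0 ?sqr_ge0.
have h3 : X ^+ 2 <= (32 * u) ^+ 2 by rewrite ler_pXn2r// nnegrE// mulr_ge0.
have h4 : area q s t ^+ 2 <= (K * u) ^+ 2.
  rewrite -[leLHS]ger0_norm ?sqr_ge0// normrX ler_pXn2r// nnegrE mulr_ge0//; lra.
apply: (@le_trans _ _ ((32 * u) ^+ 2 + 16 * (K * u) ^+ 2)); first by lra.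
have -> : (32 * u) ^+ 2 + 16 * (K * u) ^+ 2 = (1024 + 16 * K ^+ 2) * u ^+ 2 by ring.
have -> : ((4 * K) ^+ 2 * u) ^+ 2 = 256 * (K ^+ 2 * K ^+ 2) * u ^+ 2 by ring.
rewrite ler_wpM2r ?sqr_ge0//.
have : 256 <= K ^+ 2 by nra.
nra.
Qed.

Lemma scale_continuous (phi : R -> R) m : 0 < m ->
  (forall s t n, b ^+ n * `|t - s| <= 1 -> `|phi t - phi s| <= m * r ^+ n) ->
  continuous phi.
Proof.
move=> m0 phim s; apply/(@cvgrPdist_lt _ R) => e e0.
have four : 2 <= 4 :> R by lra.
have [n hn] := unbounded_expr four (divr_gt0 e0 m0).
have bn0 : 0 < b ^+ n by rewrite exprn_gt0.
near=> t; rewrite distrC; apply: le_lt_trans (phim s t n _) _.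
  rewrite mulrC -ler_pdivlMr// mul1r distrC ltW//.
  by near: t; apply: cvgr_dist_lt; [exact: cvg_id|rewrite invr_gt0].
by move: hn; rewrite mulrA ltr_pdivlMr// mul1r exprVn ltr_pdivrMr ?exprn_gt0// mulrC.
Unshelve. all: by end_near. Qed.

(** The vertical coordinate of [(curve t)^-1 (v, w, z)] changes sign with [t], since
    the linear part of [curvez] dominates. *)
Lemma curve_horizontal_point v w z : q < 1 ->
  exists t, z - curvez q t - 2^-1 * (curvex q t * w - curvey q t * v) = 0.
Proof.
move=> q1.
have kap0 : 0 < kappa by rewrite invr_gt0; lra.
pose phi t := curvez q t + 2^-1 * (curvex q t * w - curvey q t * v).
pose M := `|kappa| + 16 + 8 + 2 * `|w| + 2 * `|v|.
have M0 : 0 < M.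
  by rewrite /M; have := normr_ge0 kappa; have := normr_ge0 w; have := normr_ge0 v; lra.
have cphi : continuous phi.
  apply: (scale_continuous M0) => s t n hn.
  have r0 : 0 <= r ^+ n by rewrite exprn_ge0.
  have hx := curvex_dist q_ge q_le hn; have hy := curvey_dist q_ge q_le hn.
  have hA : `|area q s t| <= (`|kappa| + 16) * r ^+ n.
    apply: le_trans (area_le hn) _; rewrite ler_wpM2l ?addr_ge0// -r2E expr2.
    by rewrite ler_piMl// exprn_ile1//; lra.
  have -> : phi t - phi s = area q s t +
    2^-1 * (curvex q s * (curvey q t - curvey q s) - curvey q s * (curvex q t - curvex q s)) +
    2^-1 * ((curvex q t - curvex q s) * w - (curvey q t - curvey q s) * v).
    by rewrite /phi /area; field.
  have p1 : `|curvex q s * (curvey q t - curvey q s)| <= 4 / 3 * (4 * r ^+ n).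
    by rewrite normrM ler_pM ?curvex_le.
  have p2 : `|curvey q s * (curvex q t - curvex q s)| <= 4 / 3 * (4 * r ^+ n).
    by rewrite normrM ler_pM ?curvey_le.
  have p3 : `|(curvex q t - curvex q s) * w| <= 4 * r ^+ n * `|w|.
    by rewrite normrM ler_wpM2r.
  have p4 : `|(curvey q t - curvey q s) * v| <= 4 * r ^+ n * `|v|.
    by rewrite normrM ler_wpM2r.
  move: hA p1 p2 p3 p4; rewrite /M.
  rewrite !ler_norml => /andP[? ?] /andP[? ?] /andP[? ?] /andP[? ?] /andP[? ?].
  by apply/andP; split; nra.
pose m := 1 + `|v| + `|w|.
have phim t : `|phi t - kappa * t| <= m.
  have p1 : `|curvex q t * w| <= 4 / 3 * `|w| by rewrite normrM ler_wpM2r ?curvex_le.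
  have p2 : `|curvey q t * v| <= 4 / 3 * `|v| by rewrite normrM ler_wpM2r ?curvey_le.
  have := normr_ge0 w; have := normr_ge0 v.
  move: p1 p2 (height_oscillation_le q_ge q_le t); rewrite /phi /curvez /m.
  rewrite !ler_norml => /andP[? ?] /andP[? ?] /andP[? ?] ? ?.
  by apply/andP; split; lra.
have m0 : 0 <= m by have := phim 0; apply: le_trans.
have t12 : (z - m) / kappa <= (z + m) / kappa by rewrite ler_pM2r ?invr_gt0//; lra.
have [||t _ te] := @IVT _ phi _ _ z t12.
- by apply: continuous_subspaceT.
- have := phim ((z - m) / kappa); have := phim ((z + m) / kappa).
  rewrite !(mulrCA kappa) !divff ?gt_eqF// !mulr1.
  rewrite !ler_norml => /andP[? ?] /andP[? ?].
  by rewrite ge_min le_max; apply/andP; split; apply/orP; [left|right]; lra.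
by exists t; rewrite -te /phi; ring.
Qed.

End CurveInHeisenberg.

(** * Estimates of Hausdorff dimension *)

Section HausdorffTools.
Context {R : realType} {T : Type}.
Variable d : T -> T -> R.
Hypothesis d_ge0 : forall p q, 0 <= d p q.
Implicit Types (U E : set T) (s D : R).

Lemma diam_le U m : (forall p q, U p -> U q -> d p q <= m) -> (diam d U <= m%:E)%E.
Proof. by move=> Um; apply: ge_ereal_sup => _ [[p q] [/= Up Uq] <-]; rewrite lee_fin Um. Qed.

Lemma diam_ge U p q : U p -> U q -> ((d p q)%:E <= diam d U)%E.
Proof. by move=> Up Uq; apply: ereal_sup_ubound; exists (p, q). Qed.

Lemma hausdorff_weight_ge0 s U : (0 <= hausdorff_weight d s U)%E.
Proof. by rewrite /hausdorff_weight; case: ifP => // _; exact: poweR_ge0. Qed.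

Lemma hausdorff_weight0 s : hausdorff_weight d s set0 = 0%E.
Proof. by rewrite /hausdorff_weight eqxx. Qed.

Lemma hausdorff_weight_le s U m : 0 < s -> 0 <= m ->
  (forall p q, U p -> U q -> d p q <= m) -> (hausdorff_weight d s U <= (m `^ s)%:E)%E.
Proof.
move=> s0 m0 Um; rewrite /hausdorff_weight; case: ifPn => [_|/set0P[p Up]].
  by rewrite lee_fin powR_ge0.
have U0 : (0 <= diam d U)%E.
  by apply: le_trans (diam_ge Up Up); rewrite lee_fin.
rewrite -poweR_EFin; apply: gt0_ler_poweR; rewrite ?(ltW s0)//.
- by rewrite in_itv /= U0 leey.
- by rewrite in_itv /= lee_fin m0 leey.
- exact: diam_le.
Qed.

(** Measure zero, in a form that is stable under countable unions because it names
    the covers. *)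
Definition negligible_cover s E := forall delta eta : R, 0 < delta -> 0 < eta ->
  exists U : (set T)^nat, [/\ E `<=` \bigcup_i U i,
    forall i, (diam d (U i) <= delta%:E)%E &
    (\sum_(0 <= i <oo) hausdorff_weight d s (U i) <= eta%:E)%E].

Lemma negligible_cover_measure s E : negligible_cover s E ->
  hausdorff_measure d s E = 0%E.
Proof.
move=> nE; have cont0 delta : 0 < delta -> hausdorff_content d s delta E = 0%E.
  move=> delta0; apply/eqP; rewrite eq_le; apply/andP; split.
    apply/lee_addgt0Pr => eta eta0; rewrite add0e.
    have [U [EU Ud Us]] := nE _ _ delta0 eta0.
    by apply: le_trans Us; apply: ereal_inf_lbound; exists U.
  apply: le_ereal_inf_tmp => _ [U _ <-]; apply: nneseries_ge0 => i _ _.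
  exact: hausdorff_weight_ge0.
apply/eqP; rewrite eq_le; apply/andP; split.
  by apply: ge_ereal_sup => _ [delta /= delta0 <-]; rewrite cont0.
by apply: ereal_sup_ubound; exists 1; rewrite /= ?cont0.
Qed.

(** The sets of index [m] are covered at cost [eta / 2 ^ m.+1], and the covers are
    enumerated along a bijection of [nat] with its square. *)
Lemma negligible_cover_bigcup s E (F : nat -> set T) :
  E `<=` \bigcup_m F m -> (forall m, negligible_cover s (F m)) -> negligible_cover s E.
Proof.
move=> EF nF delta eta delta0 eta0.
have e0 m : 0 < eta / (2 ^ m.+1)%:R by rewrite divr_gt0.
have [G PG] := choice (fun m => nF m _ _ delta0 (e0 m)).
have /card_esym/ppcard_eqP[f] := card_nat2.
pose w m i := hausdorff_weight d s (G m i).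
have w0 m i : (0 <= w m i)%E by exact: hausdorff_weight_ge0.
exists (fun k => G (f k).1 (f k).2); split.
- move=> x /EF [m _ Fx]; have [/(_ x Fx) [i _ Gx] _ _] := PG m.
  by exists (f^-1%FUN (m, i)) => //=; rewrite invK ?inE.
- by move=> i /=; case: (PG (f i).1).
rewrite nneseries_esumT; last by move=> k; exact: w0.
have <- : \esum_(k in [set: nat * nat]) w k.1 k.2 =
    \esum_(i in [set: nat]) w (f i).1 (f i).2.
  by rewrite (reindex_esum [set: nat] _ f).
have -> : [set: nat * nat] = [set: nat] `*`` (fun=> [set: nat]).
  by apply/seteqP; split.
rewrite -(@esum_esum _ _ _ _ _ w)//.
rewrite -nneseries_esumT; last by move=> m; apply: esum_ge0.
apply: (@le_trans _ _ (\sum_(0 <= m <oo) (0 + (eta / (2 ^ m.+1)%:R)%:E))%E).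
  apply: lee_nneseries => m _; first by move=> _; apply: esum_ge0.
  rewrite add0e -nneseries_esumT//.
  by case: (PG m).
apply: le_trans (epsilon_trick _ _ _) _ => //; first exact: ltW.
by rewrite eseries0// add0e.
Qed.

(** Covering [p @` [-M, M]] by the images of about [2 M b^n] intervals of length
    [b^-n], at a cost of [(b * r `^ s)^n] up to a constant. *)
Lemma snowflake_negligible (p : R -> T) (b r C s : R) :
  2 <= b -> 0 < r < 1 -> 0 <= C -> 0 < s -> b * r `^ s < 1 ->
  (forall u t n, b ^+ n * `|t - u| <= 1 -> d (p t) (p u) <= C * r ^+ n) ->
  hausdorff_measure d s (range p) = 0%E.
Proof.
move=> b2 /andP[r0 r1] C0 s0 brs pd; have b0 : 0 < b by lra.
apply: negligible_cover_measure.
apply: (@negligible_cover_bigcup _ _ (fun m => p @` [set t | `|t| <= m%:R])).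
  move=> _ [t _ <-]; exists (Num.bound `|t|) => //; exists t => //=.
  exact/ltW/archi_boundP.
move=> m delta eta delta0 eta0; set M := m%:R : R.
have M0 : 0 <= M by exact: ler0n.
have brs0 : 0 <= b * r `^ s by rewrite mulr_ge0 ?powR_ge0// ltW.
have small (K x e : R) : 0 <= x < 1 -> 0 < e -> \forall n \near \oo, K * x ^+ n <= e.
  move=> /andP[x0 x1] e0; have xn : `|x| < 1 by rewrite ger0_norm.
  have : K * x ^+ n @[n --> \oo] --> K * 0.
    by apply: cvgM; [exact: cvg_cst|exact: cvg_expr].
  by rewrite mulr0 => /cvgr_le; apply.
have [n [nd ne]] : exists n, C * r ^+ n <= delta /\
    ((2 * M + 1) * C `^ s) * (b * r `^ s) ^+ n <= eta.
  have r01 : 0 <= r < 1 by rewrite ltW.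
  have brs01 : 0 <= b * r `^ s < 1 by rewrite brs0.
  near \oo => n; exists n; split; near: n; exact: small.
have bn0 : 0 < b ^+ n by rewrite exprn_gt0.
pose N := (Num.truncn (2 * M * b ^+ n)).+1.
have NE : N%:R <= (2 * M + 1) * b ^+ n.
  have : (Num.truncn (2 * M * b ^+ n))%:R <= 2 * M * b ^+ n.
    by rewrite truncn_le// !mulr_ge0// ltW.
  have : 1 <= b ^+ n by rewrite exprn_ege1//; lra.
  by rewrite /N -(natr1 (Num.truncn _)); lra.
pose I i := [set t : R | i%:R <= (t + M) * b ^+ n <= i.+1%:R].
pose U i := if (i < N)%N then p @` I i else set0.
have rn0 : 0 <= C * r ^+ n by rewrite mulr_ge0// exprn_ge0// ltW.
have Ud i x y : U i x -> U i y -> d x y <= C * r ^+ n.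
  rewrite /U; case: ifP => // _ [t /andP[t1 t2] <-] [u /andP[u1 u2] <-].
  apply: pd; rewrite -[X in X * _](ger0_norm (ltW bn0)) -normrM ler_norml.
  rewrite -(natr1 i) in t2 u2.
  have -> : b ^+ n * (t - u) = (t + M) * b ^+ n - (u + M) * b ^+ n by ring.
  by apply/andP; split; lra.
exists U; split.
- move=> _ [t /= tM <-]; move: tM; rewrite ler_norml => /andP[t1 t2].
  pose i := Num.truncn ((t + M) * b ^+ n).
  have tM0 : 0 <= (t + M) * b ^+ n by rewrite mulr_ge0 ?(ltW bn0)//; lra.
  have /andP[i1 i2] := truncn_itv tM0.
  exists i => //; rewrite /U.
  have -> : (i < N)%N.
    by rewrite ltnS; apply: le_truncn; rewrite ler_wpM2r ?(ltW bn0)//; lra.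
  by exists t => //; apply/andP; split=> //; exact: ltW.
- by move=> i; apply: le_trans (diam_le (Ud i)) _; rewrite lee_fin.
rewrite (nneseries_split 0 N); last by move=> *; exact: hausdorff_weight_ge0.
rewrite add0n [X in (_ + X)%E]eseries0 ?adde0; last first.
  by move=> i Ni _; rewrite /U ltnNge Ni /= hausdorff_weight0.
apply: (@le_trans _ _ (\sum_(0 <= i < N) ((C * r ^+ n) `^ s)%:E)%E).
  by apply: lee_sum => i _; apply: hausdorff_weight_le => //; exact: Ud.
rewrite sumEFin lee_fin; apply: le_trans ne.
rewrite big_const_nat iter_addr_0 subn0 -(mulr_natl _ N).
have -> : (C * r ^+ n) `^ s = C `^ s * (r `^ s) ^+ n.
  rewrite powRM ?exprn_ge0 ?(ltW r0)//; congr (_ * _).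
  by rewrite -(powR_mulrn n (ltW r0)) -(powR_mulrn n (powR_ge0 _ _)) powRAC.
have -> : (2 * M + 1) * C `^ s * (b * r `^ s) ^+ n =
  (2 * M + 1) * b ^+ n * (C `^ s * (r `^ s) ^+ n) by rewrite exprMn; ring.
by rewrite ler_wpM2r// mulr_ge0 ?exprn_ge0 ?powR_ge0.
Unshelve. all: by end_near. Qed.

(** The mass distribution principle for the image of the Lebesgue measure of
    [[0, 1]]: a set [U] of the cover meets [p @` [0, 1]] along parameters lying in
    an interval of length [2 (diam U)^D], and these intervals cover [[0, 1]]. *)
Lemma hausdorff_dim_ge (p : R -> T) E D : 0 < D ->
  (forall t, 0 <= t <= 1 -> E (p t)) ->
  (forall u t, 0 <= u <= 1 -> 0 <= t <= 1 -> `|t - u| <= d (p t) (p u) `^ D) ->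
  (D%:E <= hausdorff_dim d E)%E.
Proof.
move=> D0 Ep pd; apply: le_ereal_inf_tmp => _ [s [s0 Es] <-].
rewrite lee_fin leNgt; apply/negP => sD.
have : (hausdorff_content d s 1 E < 4^-1%:E)%E.
  apply: (@le_lt_trans _ _ 0%E); last by rewrite lte_fin.
  by rewrite -Es; apply: ereal_sup_ubound; exists 1 => //=.
move=> /ereal_inf_lt [_ [U [EU Ud] <-] Us].
have cov i : exists I : set R, [/\ measurable I,
    forall t, 0 <= t <= 1 -> U i (p t) -> I t &
    (lebesgue_measure I <= 2%:E * hausdorff_weight d s (U i))%E].
  have [[t [t01 Ut]]|nU] := pselect (exists t, 0 <= t <= 1 /\ U i (p t)); last first.
    exists set0; split=> //; first by move=> t t01 Ut; apply: nU; exists t.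
    by rewrite measure0 mule_ge0// hausdorff_weight_ge0.
  have [m [m0 m1 mE]] : exists m, [/\ 0 <= m, m <= 1 & diam d (U i) = m%:E].
    have := Ud i; have := diam_ge Ut Ut.
    case: (diam d (U i)) => [m||]//; rewrite !lee_fin => m0 m1.
    by exists m; split=> //; exact: le_trans m0.
  have mDs : m `^ D <= m `^ s.
    have [->|mn0] := eqVneq m 0; first by rewrite powR0 ?gt_eqF// powR_ge0.
    by apply: ger_powR (ltW sD); rewrite lt_neqAle eq_sym mn0 m0.
  exists `[t - m `^ D, t + m `^ D]%classic; split.
  - exact: measurable_itv.
  - move=> u u01 Uu; rewrite /= in_itv /=.
    have : `|u - t| <= m `^ D.
      apply: le_trans (pd _ _ t01 u01) _.
      apply: ge0_ler_powR; rewrite ?(ltW D0)// ?nnegrE//.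
      by rewrite -lee_fin -mE diam_ge.
    by rewrite ler_norml => /andP[? ?]; apply/andP; split; lra.
  rewrite /hausdorff_weight ifF; last first.
    by apply/negP => /eqP U0; move: Ut; rewrite U0.
  rewrite lebesgue_measure_itv /= mE poweR_EFin -EFinM; case: ifP => _.
    by rewrite -EFinD lee_fin; lra.
  by rewrite lee_fin mulr_ge0// powR_ge0.
have [I /all_and3[mI UI leI]] := choice cov.
have : (lebesgue_measure (`[0%R, 1%R]%classic : set R) <=
    \sum_(0 <= i <oo) lebesgue_measure (I i))%E.
  apply: (@measure_sigma_subadditive _ _ _ lebesgue_measure _ I mI (measurable_itv _)).
  move=> t /=; rewrite in_itv /= => t01.
  by have [i _ Ut] := EU _ (Ep _ t01); exists i => //; exact: UI.
rewrite lebesgue_measure_itv /= lte_fin ltr01 oppr0 adde0.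
apply/negP; rewrite -ltNge.
apply: (@le_lt_trans _ _ (2%:E * \sum_(0 <= i <oo) hausdorff_weight d s (U i))%E).
  rewrite -nneseriesZl; last by move=> i _; exact: hausdorff_weight_ge0.
  by apply: lee_nneseries.
apply: (@lt_trans _ _ (2%:E * 4^-1%:E)%E); first by rewrite lte_pmul2l.
by rewrite -EFinM lte_fin; lra.
Qed.

End HausdorffTools.

(** * Intersections of two entire graphs *)

(** In other words [2 + ln u / ln 4] is the dimension attached to the ratios [4^-1]
    for distances and [(16 * u)^-1] for parameters. *)
Lemma powR_quarter {R : realType} (u : R) : 0 < u ->
  4^-1 `^ (2 + ln u / ln 4) = (16 * u)^-1.
Proof.
move=> u0; have l4 : 0 < ln 4 :> R by rewrite ln_gt0//; lra.
rewrite powRD; last by apply/implyP => _; rewrite invr_eq0.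
have -> : 4^-1 `^ 2 = 16^-1 :> R.
  by rewrite powR_mulrn// exprVn -natrX.
rewrite /powR invr_eq0 ifF; last by apply/negbTE.
rewrite lnV ?posrE// mulrN divfK ?gt_eqF//.
by rewrite expRN lnK ?posrE// invfM.
Qed.

Section CurvePairs.
Context {R : realType}.

Lemma hfun_curve_dist (q a b m : R) p p' :
  3 / 4 <= q -> q <= 5 / 4 -> q != 1 -> a ^+ 2 + b ^+ 2 = 1 ->
  0 <= m -> 8 <= m ^+ 2 * (`|height_slope q| / 20 - 16) ->
  range (curve q) p -> range (curve q) p' ->
  `|hfun a b p - hfun a b p'| <= m * hdist p p'.
Proof.
move=> q34 q54 q1 ab m0 hm [t _ <-] [s _ <-].
have := curve_vertical q34 q54 q1 s t m0 hm.
set d := m * _; have d0 : 0 <= d by rewrite mulr_ge0// hdist_ge0.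
rewrite /hfun /=; set u := curvex q t - _; set v := curvey q t - _ => uv.
rewrite (_ : _ - _ = a * u + b * v); last by rewrite /u /v; ring.
rewrite -(@ler_pXn2r _ 2)// ?nnegrE// -normrX ger0_norm ?sqr_ge0//.
apply: le_trans uv; rewrite -[leRHS]mul1r -ab.
by have := sqr_ge0 (a * v - b * u); nra.
Qed.

Lemma entire_graph_through_curve (q a b m lam : R) :
  3 / 4 <= q -> q <= 5 / 4 -> q != 1 -> a ^+ 2 + b ^+ 2 = 1 ->
  0 <= m -> m <= lam -> lam < 1 -> 8 <= m ^+ 2 * (`|height_slope q| / 20 - 16) ->
  exists G, [/\ entire_ilip_graph (hplane a b) lam G, range (curve q) `<=` G &
    forall p p', G p -> G p' -> `|hfun a b p - hfun a b p'| <= m * hdist p p'].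
Proof.
move=> q34 q54 q1 ab m0 mlam lam1 hm.
have m1 : m < 1 by exact: le_lt_trans lam1.
have [|G [EG Gent Gl]] := entire_extension ab m0 m1 (E := range (curve q)) _
    (fun p p' => @hfun_curve_dist q a b m p p' q34 q54 q1 ab m0 hm).
  by exists (curve q 0), 0.
exists G; split=> //; split=> //; apply: (ilip_hfun ab) => p p' Gp Gp'.
by apply: le_trans (Gl _ _ Gp Gp') _; rewrite ler_wpM2r// hdist_ge0.
Qed.

(** Cramer's rule bounds [(u, v)] by the two linear forms, which are assumed to be
    small compared with [(u, v)]. *)
Lemma transverse_eq0 (a b a' b' m u v : R) :
  a ^+ 2 + b ^+ 2 = 1 -> a' ^+ 2 + b' ^+ 2 = 1 ->
  8 * m ^+ 2 < (a * b' - a' * b) ^+ 2 ->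
  (a * u + b * v) ^+ 2 <= m ^+ 2 * (u ^+ 2 + v ^+ 2) ->
  (a' * u + b' * v) ^+ 2 <= m ^+ 2 * (u ^+ 2 + v ^+ 2) -> u ^+ 2 + v ^+ 2 = 0.
Proof.
move=> ab ab' hm; set X := a * u + b * v; set Y := a' * u + b' * v.
set N := u ^+ 2 + v ^+ 2 => hX hY.
have N0 : 0 <= N by rewrite addr_ge0 ?sqr_ge0.
have e : (a * b' - a' * b) ^+ 2 * N = (b' * X - b * Y) ^+ 2 + (a * Y - a' * X) ^+ 2.
  by rewrite /N /X /Y; ring.
have le2 : (b' * X - b * Y) ^+ 2 + (a * Y - a' * X) ^+ 2 <= 2 * (X ^+ 2 + Y ^+ 2).
  have -> : 2 * (X ^+ 2 + Y ^+ 2) =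
      2 * ((a' ^+ 2 + b' ^+ 2) * X ^+ 2 + (a ^+ 2 + b ^+ 2) * Y ^+ 2).
    by rewrite ab ab' !mul1r.
  rewrite -subr_ge0 (_ : _ - _ = (b' * X + b * Y) ^+ 2 + (a * Y + a' * X) ^+ 2).
    by rewrite addr_ge0 ?sqr_ge0.
  by ring.
apply/eqP; rewrite eq_le N0 andbT leNgt; apply/negP => Npos.
have : 8 * m ^+ 2 * N < (a * b' - a' * b) ^+ 2 * N by rewrite ltr_pM2r.
have : 0 <= m ^+ 2 * N by rewrite mulr_ge0 ?sqr_ge0.
by rewrite e; lra.
Qed.

Lemma hplane_neq (a b a' b' : R) :
  a ^+ 2 + b ^+ 2 = 1 -> a' ^+ 2 + b' ^+ 2 = 1 ->
  hplane a b <> hplane a' b' -> a * b' - a' * b != 0.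
Proof.
move=> ab ab' W; apply/eqP => D0; apply: W.
pose c := a * a' + b * b'.
have e : a' = c * a /\ b' = c * b.
  split.
    transitivity (a' * (a ^+ 2 + b ^+ 2) + b * (a * b' - a' * b)).
      by rewrite ab D0; ring.
    by rewrite /c; ring.
  transitivity (b' * (a ^+ 2 + b ^+ 2) - a * (a * b' - a' * b)).
    by rewrite ab D0; ring.
  by rewrite /c; ring.
have c0 : c != 0.
  apply/eqP => c0; move: ab'; case: e => -> ->; rewrite c0 !mul0r expr0n addr0.
  by move/esym/eqP; rewrite oner_eq0.
have hE p : hfun a' b' p = c * hfun a b p.
  by case: e => -> ->; rewrite /hfun; ring.
apply/seteqP; split => p; rewrite /hplane /mkset hE; first by move=> ->; rewrite mulr0.
by move/eqP; rewrite mulf_eq0 (negbTE c0) => /eqP.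
Qed.

(** The two graphs being Lipschitz in transverse directions, no point of their
    intersection can be horizontally aligned with another one; but every point of
    the group is horizontally aligned with a point of the curve. *)
Lemma curve_maximal (q a b a' b' m : R) (G G' : set (heis R)) :
  3 / 4 <= q -> q < 1 ->
  a ^+ 2 + b ^+ 2 = 1 -> a' ^+ 2 + b' ^+ 2 = 1 ->
  8 * m ^+ 2 < (a * b' - a' * b) ^+ 2 ->
  (forall p p', G p -> G p' -> `|hfun a b p - hfun a b p'| <= m * hdist p p') ->
  (forall p p', G' p -> G' p' -> `|hfun a' b' p - hfun a' b' p'| <= m * hdist p p') ->
  range (curve q) `<=` G -> range (curve q) `<=` G' ->
  G `&` G' `<=` range (curve q).
Proof.
move=> q34 q1 ab ab' hm Gl Gl' EG EG' [[v w] z] [Gp Gp'].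
have q54 : q <= 5 / 4 by lra.
have qn1 : q != 1 by rewrite lt_eqF.
have [t ht] := curve_horizontal_point q34 q54 qn1 v w z q1.
have Ec : range (curve q) (curve q t) by exists t.
have := Gl _ _ Gp (EG _ Ec); have := Gl' _ _ Gp' (EG' _ Ec).
rewrite /curve hdistE ht; set d := koranyi _.
have d0 : 0 <= d by exact: koranyi_ge0.
have d2 : d ^+ 2 = (v - curvex q t) ^+ 2 + (w - curvey q t) ^+ 2.
  apply/eqP; rewrite -(@eqrXn2 _ 2) ?sqr_ge0 ?addr_ge0 ?sqr_ge0//.
  by rewrite -exprM koranyi4 expr0n mulr0 addr0.
have sq (x y X : R) : X = x - y -> `|x - y| <= m * d -> X ^+ 2 <= m ^+ 2 * d ^+ 2.
  move=> -> h; rewrite -exprMn -[leLHS]ger0_norm ?sqr_ge0// normrX.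
  by rewrite ler_pXn2r// nnegrE; exact: le_trans h.
set u := v - _ in d2; set u' := w - _ in d2.
move=> /(sq _ _ (a' * u + b' * u')) h' /(sq _ _ (a * u + b * u')) h.
have := @transverse_eq0 a b a' b' m u u' ab ab' hm.
rewrite -d2 => /(_ (h _) (h' _)) e.
have {e} : d ^+ 2 = 0 by apply: e; rewrite /u /u' /hfun /=; ring.
rewrite d2 => /eqP; rewrite paddr_eq0 ?sqr_ge0// !sqrf_eq0 !subr_eq0.
move=> /andP[/eqP vE /eqP wE]; exists t => //.
move: ht; rewrite vE wE /curve (mulrC (curvex q t)) subrr mulr0 subr0 => /eqP.
by rewrite subr_eq0 => /eqP ->.
Qed.

Lemma slope_choice (m : R) : 0 < m -> exists e : R,
  [/\ 0 < e, e <= 4^-1, 8 <= m ^+ 2 * ((2 * e)^-1 / 20 - 16) & 1 <= (2 * e)^-1 / 20 - 16].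
Proof.
move=> m0; pose L := 17 + 8 / m ^+ 2.
have m2 : 0 < m ^+ 2 by rewrite exprn_gt0.
have L17 : 17 <= L by rewrite lerDl divr_ge0// ltW.
have e1 : (2 * (40 * L)^-1)^-1 / 20 - 16 = 1 + 8 / m ^+ 2.
  transitivity (L - 16); last by rewrite /L; ring.
  by field; lra.
exists (40 * L)^-1; split.
- by rewrite invr_gt0; lra.
- by rewrite lef_pV2 ?posrE//; lra.
- rewrite e1 mulrDr mulr1 mulrCA divff ?gt_eqF//; lra.
- by rewrite e1 lerDl divr_ge0// ltW.
Qed.

End CurvePairs.

Theorem corollary1p5 (R : realType) (W1 W2 : set (heis R)) (lam : R)
  (hW1 : vertical_plane W1) (hW2 : vertical_plane W2) (hW12 : W1 <> W2)
  (hlam0 : 0 < lam) (hlam1 : lam < 1) :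
  (exists G1 G2 : set (heis R),
     [/\ entire_ilip_graph W1 lam G1,
         entire_ilip_graph W2 lam G2
       & (hausdorff_dim hdist (G1 `&` G2) < 2%:E)%E]) /\
  (exists G1 G2 : set (heis R),
     [/\ entire_ilip_graph W1 lam G1,
         entire_ilip_graph W2 lam G2
       & (2%:E < hausdorff_dim hdist (G1 `&` G2))%E]).
Proof.
have [a [b [ab W1E]]] := vertical_planeP hW1.
have [a' [b' [ab' W2E]]] := vertical_planeP hW2.
move: hW12; rewrite {}W1E {}W2E => /(hplane_neq ab ab') D0.
pose m := Order.min lam (`|a * b' - a' * b| / 4).
have m0 : 0 < m by rewrite lt_min hlam0 divr_gt0// normr_gt0.
have mlam : m <= lam by rewrite ge_min lexx.
have hm : 8 * m ^+ 2 < (a * b' - a' * b) ^+ 2.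
  rewrite -[ltRHS]ger0_norm ?sqr_ge0// normrX.
  have mD : m <= `|a * b' - a' * b| / 4 by rewrite ge_min lexx orbT.
  have Dp : 0 < `|a * b' - a' * b| by rewrite normr_gt0.
  have : m ^+ 2 <= (`|a * b' - a' * b| / 4) ^+ 2.
    by rewrite ler_pXn2r ?nnegrE ?(ltW m0)// (le_trans (ltW m0)).
  have : 0 < `|a * b' - a' * b| ^+ 2 by rewrite exprn_gt0.
  by rewrite expr_div_n; lra.
have [e [e0 e4 he he1]] := slope_choice m0.
have l4 : 0 < ln 4 :> R by rewrite ln_gt0//; lra.
split.
- pose q := 1 - e.
  have kE : `|height_slope q| = (2 * e)^-1.
    rewrite /height_slope /q (_ : 1 - (1 - e) = e); last by ring.
    by rewrite ger0_norm// invr_ge0; lra.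
  have q34 : 3 / 4 <= q by rewrite /q; lra.
  have q54 : q <= 5 / 4 by rewrite /q; lra.
  have q1 : q < 1 by rewrite /q; lra.
  have qn1 : q != 1 by rewrite lt_eqF.
  rewrite -kE in he he1.
  have [G1 [eG1 cG1 lG1]] :=
    entire_graph_through_curve q34 q54 qn1 ab (ltW m0) mlam hlam1 he.
  have [G2 [eG2 cG2 lG2]] :=
    entire_graph_through_curve q34 q54 qn1 ab' (ltW m0) mlam hlam1 he.
  exists G1, G2; split=> //.
  have -> : G1 `&` G2 = range (curve q).
    apply/seteqP; split; first exact: (curve_maximal q34 q1 ab ab' hm).
    by move=> p cp; split; [exact: cG1|exact: cG2].
  have u0 : 0 < (1 + q) / 2 by lra.
  have u1 : (1 + q) / 2 < 1 by lra.
  (* Any s between the dimension 2 + ln q / ln 4 and 2 would do. *)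
  pose s := 2 + ln ((1 + q) / 2) / ln 4.
  have s2 : s < 2.
    by rewrite -ltrBrDl subrr pmulr_llt0 ?invr_gt0// ln_lt0// u0.
  have s0 : 0 < s.
    rewrite -ltrBlDl sub0r ltr_pdivlMr//.
    have : ln 4^-1 < ln ((1 + q) / 2) by rewrite ltr_ln ?posrE//; lra.
    by rewrite lnV ?posrE//; lra.
  apply: (@le_lt_trans _ _ s%:E); last by rewrite lte_fin.
  apply: ereal_inf_lbound; exists s => //; split; first exact: ltW.
  apply: (@snowflake_negligible _ _ _ (@hdist_ge0 R) (curve q) (16 * q) 4^-1
    (4 * (`|height_slope q| + 16)) s) => //.
  + lra.
  + by apply/andP; split; lra.
  + rewrite powR_quarter// ltr_pdivrMr; lra.
  + by move=> u t n; exact: curve_dist_le.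
- pose q := 1 + e.
  have kE : `|height_slope q| = (2 * e)^-1.
    rewrite /height_slope /q (_ : 2 * (1 - (1 + e)) = - (2 * e)); last by ring.
    by rewrite invrN normrN ger0_norm// invr_ge0; lra.
  have q34 : 3 / 4 <= q by rewrite /q; lra.
  have q54 : q <= 5 / 4 by rewrite /q; lra.
  have q1 : 1 < q by rewrite /q; lra.
  have qn1 : q != 1 by rewrite gt_eqF.
  rewrite -kE in he he1.
  have [G1 [eG1 cG1 _]] :=
    entire_graph_through_curve q34 q54 qn1 ab (ltW m0) mlam hlam1 he.
  have [G2 [eG2 cG2 _]] :=
    entire_graph_through_curve q34 q54 qn1 ab' (ltW m0) mlam hlam1 he.
  exists G1, G2; split=> //.
  pose D := 2 + ln q / ln 4.
  have D2 : 2 < D by rewrite ltrDl divr_gt0// ln_gt0.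
  apply: (@lt_le_trans _ _ D%:E); first by rewrite lte_fin.
  apply: (@hausdorff_dim_ge _ _ _ (@hdist_ge0 R) (curve q)); first by lra.
    by move=> t _; split; [apply: cG1|apply: cG2]; exists t.
  move=> u t /andP[u0 u1] /andP[t0 t1].
  have [->|tu] := eqVneq t u; first by rewrite subrr normr0 powR_ge0.
  have tu0 : 0 < `|t - u| by rewrite normr_gt0 subr_eq0.
  have tu1 : `|t - u| <= 1 by rewrite ler_norml; apply/andP; split; lra.
  have [n [hn dn]] := curve_dist_ge q34 q54 qn1 he1 tu0 tu1.
  have r0 : 0 <= 4^-1 :> R by lra.
  apply: (@le_trans _ _ ((4^-1 ^+ n) `^ D)); last first.
    by apply: ge0_ler_powR; rewrite ?nnegrE ?exprn_ge0 ?hdist_ge0//; lra.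
  rewrite -(powR_mulrn n r0) powRAC powR_quarter; last by lra.
  rewrite powR_mulrn; last by rewrite invr_ge0; lra.
  have bn : 0 < (16 * q) ^+ n by rewrite exprn_gt0//; lra.
  by rewrite exprVn -[leRHS]mulr1 ler_pdivlMl.
Qed.
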